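(* Under the standing assumptions described in the context (two parameters $\lambda,\mu$), suppose that $|X_0|=k\omega_{bif}$ for some $k\in\mathbb Z$, $k\ne0$. Write $$X_G(q,\lambda,\mu)=x_0(q,\lambda,\mu)X_0^1+x_1(q,\lambda,\mu)X_1+x_2(q,\lambda,\mu)X_2 .$$ If $\frac{\partial x_0}{\partial\mu}(0,0,0)\ne k\,\frac{d}{d\mu}\omega_{0,\mu}\big|_{\mu=0}$, then there exists a sufficiently $CS$ curve $\mu=\mu(\lambda)$, $\lambda\ge0$ small, with $\mu(0)=0$, and there exists a sufficiently $CS$ branch of orbitally stable modulated rotating waves $\mathbf\Phi(t,u_{\lambda,\mu(\lambda)},\lambda,\mu(\lambda))$, $\lambda>0$ small, with a primary frequency vector $\overrightarrow{X(\lambda,\mu(\lambda))}$ orthogonal to $\overrightarrow{X_0}$.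
   Context: Regularity conventions. ''Sufficiently smooth'' means of class $C^m$ with $m\ge1$ as large as required, the data being assumed $C^M$ with $M$ large enough. A function $Y(x,\lambda,\mu)$, $\lambda\in[0,\lambda_0)$, is called sufficiently $CS$ if $(x,\epsilon,\mu)\mapsto Y(x,\epsilon^2,\mu)$ is sufficiently smooth for $\epsilon\in[0,\sqrt{\lambda_0})$ (similarly without $\mu$). The equation. Let $r_0>0$, $\mathbf S^2\subset\mathbb R^3$ the unit sphere, $N\ge1$, $D_{\rm diff}=\mathrm{diag}(d_1,\dots,d_N)$ with $d_i\ge0$, $\Delta_S$ the Laplace-Beltrami operator on $r_0\mathbf S^2$, $F:\mathbb R^N\times\mathbb R\times\mathbb R\to\mathbb R^N$ sufficiently smooth with $F(0,\lambda,\mu)=0$ for $|\lambda|,|\mu|$ small. Consider $\partial_tu=D_{\rm diff}\Delta_Su+F(u,\lambda,\mu)$ on $r_0\mathbf S^2$. Let $\mathbf Y=L^2(r_0\mathbf S^2,\mathbb R^N)$ if all $d_i>0$ and $\mathbf Y=H^2(r_0\mathbf S^2,\mathbb R^N)$ otherwise; let $\alpha\in(\frac12,1)$ and let $\mathbf Y^\alpha$ be the domain of $(I-D_{\rm diff}\Delta_S)^\alpha$. The equation defines a sufficiently smooth local semiflow $\mathbf\Phi(t,u,\lambda,\mu)$ on $\mathbf Y^\alpha$, equivariant under $(Au)(x)=u(A^{-1}x)$, $A\in SO(3)$. $so(3)$ is the space of real antisymmetric $3\times3$ matrices; $I_3,O_3$ are the identity and zero matrices; for $Y\in so(3)$, $\overrightarrow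 Y\in\mathbb R^3$ is the vector with $Yw=\overrightarrow Y\times w$ for all $w$ (so $\overrightarrow{[X,Y]}=\overrightarrow X\times\overrightarrow Y$) and $|Y|=\|\overrightarrow Y\|$. Standing assumptions. $u_0\in\mathbf Y^\alpha$ has trivial isotropy $\{I_3\}$ and is a relative equilibrium, not an equilibrium, at $(\lambda,\mu)=(0,0)$: $\mathbf\Phi(t,u_0,0,0)=e^{X_0t}u_0$, $X_0\in so(3)$, $X_0\ne O_3$. With $L=D_{\rm diff}\Delta_S+D_uF(u_0,0,0)-X_0$ ($X_0$ acting as infinitesimal generator), $\sigma(L)\cap\{\mathrm{Re}\,z\ge0\}$ is a spectral set with spectral projection $P_*$, $\dim R(P_* )=5$, and $|e^{Lt}|_{R(1-P_* )}|\le Ce^{-\beta_0t}$ for some $C,\beta_0>0$. Then (equivariant center manifold reduction), with $V_*$ the orthogonal complement of $T_{u_0}(SO(3)u_0)$ in $R(P_* )$, there are a center manifold $M^{cu}_{u_0}(\lambda,\mu)$ diffeomorphic to $SO(3)\times V_*$ via $(A,q)\mapsto A\Psi(q)$ ($\Psi$ a local chart) and sufficiently smooth $X_G:V_*\times\mathbb R^2\to so(3)$, $X_N:V_*\times\mathbb R^2\to V_*$ with $X_G(0,0,0)=X_0$, $X_N(0,0,0)=0$, such that solutions of $\dot A=AX_G(q,\lambda,\mu)$, $\dot q=X_N(q,\lambda,\mu)$ correspond to solutions on $M^{cu}_{u_0}(\lambda,\mu)$ for $|\lambda|,|\mu|$ small. A supercritical Hopf bifurcation occurs in $\dot q=X_N(q,\lambda,\mu)$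 at $q=0$, $(\lambda,\mu)=(0,0)$: $X_N(0,\lambda,\mu)=0$ for $|\lambda|,|\mu|$ small; $D_qX_N(0,\lambda,\mu)$ has eigenvalues $\alpha(\lambda,\mu)\pm i(\omega_{bif}+\beta(\lambda,\mu))$ with $\alpha(0,0)=\beta(0,0)=0$, $\alpha_\lambda(0,0)>0$, $\omega_{bif}\ne0$; the curve of Hopf points $\alpha(\lambda,\mu)=0$ is $\lambda=0$ for $|\mu|$ small; for $\lambda>0$ small and $|\mu|$ small there is a bifurcating stable periodic solution $q(t,\lambda,\mu)=\sqrt\lambda\,r(t,\lambda,\mu)$, sufficiently $CS$, of period $T(\lambda,\mu)=\frac{2\pi}{|\omega_{\lambda,\mu}|}$, $\omega_{\lambda,\mu}=\omega_{bif}+O(\mu)+\lambda s(\lambda,\mu)$; $q(t,0,\mu)=0$. Basis. $X_0^1=\frac1{|X_0|}X_0$, and $X_1,X_2\in so(3)$ are chosen so that $\overrightarrow{X_0^1},\overrightarrow{X_1},\overrightarrow{X_2}$ is an orthonormal basis of $\mathbb R^3$ with $[X_0^1,X_1]=X_2$, $[X_1,X_2]=X_0^1$, $[X_2,X_0^1]=X_1$. The branch. $\mathbf\Phi(t,u_{\lambda,\mu},\lambda,\mu)=A(t,\lambda,\mu)\Psi(q(t,\lambda,\mu))$, $u_{\lambda,\mu}=\Psi(q(0,\lambda,\mu))$, where $\dot A=AX_G(q(t,\lambda,\mu),\lambda,\mu)$, $A(0)=I_3$, is the sufficiently $CS$ branch of solutions given by the Hopf bifurcation; at $\lambda=0$,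 $\mathbf\Phi(t,u_{0,\mu},0,\mu)=e^{X_G(0,0,\mu)t}u_{0,\mu}$, and for $\lambda>0$ small each solution is an orbitally stable modulated rotating wave or periodic solution of period $T(\lambda,\mu)$. $X(\lambda,\mu)$ is the sufficiently $CS$ branch in $so(3)$ with $A(T(\lambda,\mu),\lambda,\mu)=e^{X(\lambda,\mu)T(\lambda,\mu)}$ (so $e^{X(0,\mu)T(0,\mu)}=e^{X_G(0,0,\mu)T(0,\mu)}$) and $X(\lambda,\mu)T(\lambda,\mu)\in q(D)$; for $\lambda>0$, $\overrightarrow{X(\lambda,\mu)}$ is a primary frequency vector of $\mathbf\Phi(t,u_{\lambda,\mu},\lambda,\mu)$. Here $D$ is the quotient of $\{Y\in so(3)\mid|Y|\le\pi\}$ identifying $Y$ with $-Y$ when $|Y|=\pi$ (so $[Y]\mapsto e^Y$ is a diffeomorphism $D\to SO(3)$), and $q([Y])=Y$ if $Y=O_3$ or $\frac1{|Y|}\overrightarrow Y$, $\frac1{|X_0|}\overrightarrow{X_0}$ lie in the same hemisphere of $\mathbf S^2$, $q([Y])=\left(1-\frac{2\pi}{|Y|}\right)Y$ otherwise (elements of norm $2\pi$ identified with $O_3$, $q$ regarded as smooth onto its image, the smooth structure being transported from $D$); the north hemisphere is $\{(x,y,z)\in\mathbf S^2\mid z>0,\text{ or }z=0,\ x\in[-1,1),\ y\in[0,1]\}$ and the south hemisphere its complement. Terminology. For $u$ with trivial isotropy, if $\mathbf\Phi(T,u)=e^{XT}u$, $\mathbf\Phi(t,u)\notin SO(3)u$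 for $t\in(0,T)$, the orbit is not in a relative equilibrium and $|X|T\ne2l\pi$ for all $l\in\mathbb Z$, then $\mathbf\Phi(\cdot,u)$ is a modulated rotating wave with primary frequency vector $\overrightarrow X$ (for a $T$-periodic solution, any $\overrightarrow X$ with $|X|=\frac{2l\pi}T$ is called a primary frequency vector). Orbital stability is stability of the set $\{A\mathbf\Phi(t,u)\mid A\in SO(3),t\ge0\}$ under the semiflow.
   Formalization: Where X(λ,μ(λ))=0 (e.g. X_G always parallel to X_0 by reflection symmetry) the solution is periodic, not a modulated rotating wave; the formal theorem claims a modulated rotating wave only when X(λ,μ(λ))≠0, and otherwise a periodic solution with that frequency vector. *)

(* Defs.v *)
From HB Require Import structures.
From mathcomp Require Import all_boot all_order all_algebra.
From mathcomp Require Import all_classical all_reals all_analysis.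
From mathcomp Require Import complex.
Set Implicit Arguments.
Unset Strict Implicit.
Unset Printing Implicit Defensive.
Import Order.TTheory GRing.Theory Num.Theory numFieldNormedType.Exports.
Local Open Scope classical_set_scope.
Local Open Scope ring_scope.

Section Smoothness.
Variable R : realType.

(* [Ck k U f], for U open.  The successor step asks for a Frechet derivative
   whose tangent map (x, v) |-> Df(x) v is again C^k.  For finite-dimensional E
   this is the usual C^k.  In infinite dimension it lies between the classical
   C^k and C^(k-1), because (x, v) |-> Df(x) v is only asked to be jointly
   continuous at the last step. *)
Fixpoint Ck (k : nat) (E F : normedModType R) (U : set E) (f : E -> F) : Prop :=
  if k is k'.+1 then
    (forall x, U x -> differentiable f x) /\
    @Ck k' (E * E)%type F (U `*` [set: E]) (fun p : E * E => 'd f (p.1) (p.2))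
  else forall x, U x -> {for x, continuous f}.

(* C^k on an arbitrary subset: locally the restriction of a C^k map defined on
   an open set.  This covers half-open domains, submanifolds and subspaces. *)
Definition smooth_on (k : nat) (E F : normedModType R) (D : set E) (f : E -> F)
    : Prop :=
  forall x, D x -> exists (U : set E) (g : E -> F),
    [/\ open U, U x, Ck k U g & forall y, U y -> D y -> g y = f y].

Definition diffeo_onto_image (k : nat) (E F : normedModType R) (D : set E)
    (f : E -> F) : Prop :=
  smooth_on k D f /\
  exists g : F -> E, (forall x, D x -> g (f x) = x) /\ smooth_on k (f @` D) g.

(* Y(x, lambda), x in P, 0 <= lambda < lam0, is CS (of class C^k) when
   (x, eps) |-> Y(x, eps^2) is C^k for 0 <= eps < sqrt lam0.  The parameter mu,
   when present, is one of the components of x. *)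
Definition CS (k : nat) (U F : normedModType R) (P : set U) (lam0 : R)
    (Y : U -> R -> F) : Prop :=
  smooth_on k [set p : U * R | P p.1 /\ 0 <= p.2 < Num.sqrt lam0]
    (fun p : U * R => Y p.1 (p.2 ^+ 2)).

Definition CS_curve (k : nat) (F : normedModType R) (lam0 : R) (Y : R -> F)
    : Prop :=
  smooth_on k [set e : R | 0 <= e < Num.sqrt lam0] (fun e : R => Y (e ^+ 2)).

End Smoothness.

Section Rotations.
Variable R : realType.
Implicit Types (v w : 'cV[R]_3) (X Y : 'M[R]_3).

Definition dotv v w : R := (v^T *m w) 0 0.
(* The norm of 'cV[R]_3 provided by the library is the sup norm. *)
Definition enorm v : R := Num.sqrt (dotv v v).

Definition SO3 : set 'M[R]_3 := [set A | A *m A^T = 1%:M /\ \det A = 1].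
Definition so3 : set 'M[R]_3 := [set Y | Y^T = - Y].

(* For Y antisymmetric, Y *m w is the cross product of [axial Y] and w. *)
Definition axial Y : 'cV[R]_3 :=
  \col_i nth 0 [:: Y (inord 2) (inord 1); Y (inord 0) (inord 2);
                   Y (inord 1) (inord 0)] i.
Definition rnorm Y : R := enorm (axial Y).

Definition bracket X Y : 'M[R]_3 := X *m Y - Y *m X.

Definition expmx Y : 'M[R]_3 :=
  limn (series (fun n => (n`!%:R)^-1 *: Y ^+ n)).

Definition north : set 'cV[R]_3 :=
  [set v | let x := v (inord 0) 0 in let y := v (inord 1) 0 in
           let z := v (inord 2) 0 in
           0 < z \/ [/\ z = 0, -1 <= x < 1 & 0 <= y <= 1]].

Definition same_hemisphere v w : Prop := north v <-> north w.

Definition qmap X0 Y : 'M[R]_3 :=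
  if `[< Y = 0 \/ same_hemisphere ((rnorm Y)^-1 *: axial Y)
                                  ((rnorm X0)^-1 *: axial X0) >]
  then Y else (1 - 2 * pi / rnorm Y) *: Y.

(* q(D).  For rnorm Y = pi the value is the same for the representatives
   Y and - Y, exactly one of which lies in the hemisphere of X0. *)
Definition qD X0 : set 'M[R]_3 :=
  [set Z | exists Y, [/\ so3 Y, rnorm Y <= pi & Z = qmap X0 Y]].

(* CS maps into q(D), for the smooth structure transported from D.  Since
   exp (q [Y]) = exp Y and [Y] |-> exp Y is a diffeomorphism from D onto SO(3),
   a map Z into q(D) is smooth exactly when exp Z is smooth into SO(3). *)
Definition CS_qD (k : nat) (U : normedModType R) (P : set U) (lam0 : R) X0
    (Z : U -> R -> 'M[R]_3) : Prop :=
  (forall x l, P x -> 0 <= l < lam0 -> qD X0 (Z x l)) /\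
  CS k P lam0 (fun x l => expmx (Z x l)).

End Rotations.

Notation sfield R N := ('cV[R]_3 -> 'rV[R]_N).

(* d u/dt = D_diff Delta_S u + F(u, lambda, mu) on the sphere of radius [sph_radius],
   the exponent [alpha_exp] (alpha) of the phase space, and a Hilbert basis
   [efun] of L^2 made of eigenfunctions of - Delta_S with eigenvalues [eigval]
   (see [eigenbasis]).  Functions on the sphere are represented by total
   functions on R^3 whose values off the sphere are irrelevant. *)
Record rd_system (R : realType) (N : nat) := RDSystem {
  sph_radius : R;
  diffusion : 'I_N -> R;
  reaction : 'rV[R]_N * R * R -> 'rV[R]_N;
  alpha_exp : R;
  efun : nat -> 'cV[R]_3 -> R;
  eigval : nat -> R
}.

Section Spaces.
Variables (R : realType) (N : nat) (S : rd_system R N).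
Implicit Types (f g h : sfield R N) (a b : 'cV[R]_3 -> R).

Definition sphere : set 'cV[R]_3 := [set x | enorm x = sph_radius S].

(* Spherical coordinates (colatitude, longitude); the area element is
   sph_radius ^ 2 * sin (colatitude). *)
Definition sph_chart (p : measurableTypeR R * measurableTypeR R) : 'cV[R]_3 :=
  sph_radius S *: \col_i nth 0 [:: sin p.1 * cos p.2; sin p.1 * sin p.2; cos p.1] i.

Definition sph_dom : set (measurableTypeR R * measurableTypeR R) :=
  `[0, pi] `*` `[0, 2 * pi].

Definition sph_leb := (@lebesgue_measure R \x @lebesgue_measure R)%E.

Definition in_L2 a : Prop :=
  measurable_fun sph_dom (a \o sph_chart) /\
  (\int[sph_leb]_(p in sph_dom)
     ((a (sph_chart p)) ^+ 2 * (sph_radius S ^+ 2 * sin p.1))%:E < +oo)%E.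

Definition ip_L2 a b : R :=
  Rintegral sph_leb sph_dom
    (fun p => a (sph_chart p) * b (sph_chart p) * (sph_radius S ^+ 2 * sin p.1)).

Definition laplacian a (x : 'cV[R]_3) : R :=
  \sum_(i < 3) 'D_(delta_mx i 0) ('D_(delta_mx i 0) a) x.

(* Laplace-Beltrami operator: the Euclidean Laplacian of the extension which is
   homogeneous of degree 0. *)
Definition laplace_beltrami a (x : 'cV[R]_3) : R :=
  laplacian (fun y => a ((sph_radius S / enorm y) *: y)) x.

Definition eigenbasis : Prop :=
  [/\ (forall j, Ck 2 [set x | x != 0] (efun S j)),
      (forall j x, sphere x ->
         laplace_beltrami (efun S j) x = - (eigval S j * efun S j x)),
      (forall i j, ip_L2 (efun S i) (efun S j) = (i == j)%:R) &
      (forall a, in_L2 a -> (forall j, ip_L2 a (efun S j) = 0) ->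
         ip_L2 a a = 0)].

Definition coef f (i : 'I_N) (j : nat) : R :=
  ip_L2 (fun x => f x 0 i) (efun S j).

(* Y is L^2 when all the d_i are positive, and H^2 otherwise; the H^2 norm used
   is the L^2 norm of (I - Delta_S) u. *)
Definition wY (j : nat) : R :=
  if [forall i, 0 < diffusion S i] then 1 else (1 + eigval S j) ^+ 2.

(* weight of the graph norm of (I - D_diff Delta_S)^alpha in Y *)
Definition wYa (i : 'I_N) (j : nat) : R :=
  wY j * (1 + diffusion S i * eigval S j) `^ (2 * alpha_exp S).

Definition sqnorm (w : 'I_N -> nat -> R) f : \bar R :=
  (\sum_(i < N) \sum_(0 <= j <oo) (w i j * (coef f i j) ^+ 2)%:E)%E.

Definition in_space (w : 'I_N -> nat -> R) f : Prop :=
  (forall i, in_L2 (fun x => f x 0 i)) /\ (sqnorm w f < +oo)%E.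

Definition in_Y f : Prop := in_space (fun=> wY) f.
Definition normY f : R := Num.sqrt (fine (sqnorm (fun=> wY) f)).
Definition ipY f g : R :=
  \sum_(i < N) limn (series (fun j => wY j * (coef f i j * coef g i j))).

(* equality in Y, i.e. equality almost everywhere *)
Definition eqY f g : Prop := normY (fun x => f x - g x) = 0.

Definition in_Ya f : Prop := in_space wYa f.
Definition normYa f : R := Num.sqrt (fine (sqnorm wYa f)).

(* g = D_diff Delta_S f, with f in the domain of this operator in Y *)
Definition is_DLap f g : Prop :=
  [/\ in_Y f, in_Y g &
      forall i j, coef g i j = - (diffusion S i * eigval S j * coef f i j)].

Definition rotate (A : 'M[R]_3) f : sfield R N := fun x => f (invmx A *m x).

(* g = X f, the action of X in so(3) as infinitesimal generator *)
Definition is_infgen (X : 'M[R]_3) f g : Prop :=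
  [/\ in_Y f, in_Y g &
      normY (fun x => t^-1 *: (rotate (expmx (t *: X)) f x - f x) - g x)
        @[t --> 0^'] --> (0 : R)].

End Spaces.

(* The phase space Y^alpha.  Since alpha > 1/2, each of its elements has exactly
   one representative which is continuous on the sphere; [rep] is this
   representative.  The fields determine the space up to a unique isometry. *)
Record phase_space (R : realType) (N : nat) (S : rd_system R N) := PhaseSpace {
  Ya :> normedModType R;
  rep : Ya -> sfield R N;
  turn : 'M[R]_3 -> Ya -> Ya;
  rep_linear : forall (c : R) (u v : Ya) x, sphere S x ->
    rep (c *: u + v) x = c *: rep u x + rep v x;
  rep_continuous : forall u, {within sphere S, continuous (rep u)};
  rep_in : forall u, in_Ya S (rep u);
  rep_onto : forall f : sfield R N, {within sphere S, continuous f} ->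
    in_Ya S f -> exists u, forall x, sphere S x -> rep u x = f x;
  rep_norm : forall u : Ya, `|u| = normYa S (rep u);
  turn_rep : forall A u x, SO3 A -> sphere S x ->
    rep (turn A u) x = rotate A (rep u) x
}.

Section Semiflow.
Variables (R : realType) (N : nat) (S : rd_system R N) (E : phase_space S).
Implicit Types (u v : E) (t lam mu : R).

Definition smooth_system (M : nat) : Prop :=
  [/\ (0 < N)%N /\ 0 < sph_radius S,
      (forall i, 0 <= diffusion S i),
      2^-1 < alpha_exp S < 1,
      eigenbasis S &
      Ck M setT (reaction S) /\
      \forall l \near (0 : R) & m \near (0 : R), reaction S (0, l, m) = 0].

Definition is_solution (v : R -> E) (tau lam mu : R) : Prop :=
  {within `[0, tau], continuous v} /\
  forall t, 0 < t < tau ->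
    let Fv := fun x => reaction S (rep (v t) x, lam, mu) in
    in_Y S Fv /\
    exists2 g, is_DLap S (rep (v t)) g &
      normY S (fun x => h^-1 *: (rep (v (t + h)) x - rep (v t) x)
                        - (g x + Fv x)) @[h --> 0^'] --> (0 : R).

(* [Dom t u lam mu]: the solution starting at u exists on [0, t]. *)
Variables (Dom : R -> E -> R -> R -> Prop) (Phi : R -> E -> R -> R -> E).

Record local_semiflow (M : nat) : Prop := {
  sf_time : forall t u lam mu, Dom t u lam mu -> 0 <= t;
  sf_zero : forall u lam mu, Dom 0 u lam mu /\ Phi 0 u lam mu = u;
  sf_solution : forall t u lam mu, Dom t u lam mu ->
    (forall s, 0 <= s <= t -> Dom s u lam mu) /\
    is_solution (fun s => Phi s u lam mu) t lam mu;
  sf_unique : forall (v : R -> E) t lam mu, 0 <= t -> is_solution v t lam mu ->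
    Dom t (v 0) lam mu /\ Phi t (v 0) lam mu = v t;
  sf_law : forall s t u lam mu, Dom s u lam mu -> Dom t (Phi s u lam mu) lam mu ->
    Dom (s + t) u lam mu /\
    Phi (s + t) u lam mu = Phi t (Phi s u lam mu) lam mu;
  sf_continuous : {within
      [set p : R * E * R * R | Dom p.1.1.1 p.1.1.2 p.1.2 p.2], continuous
      (fun p : R * E * R * R => Phi p.1.1.1 p.1.1.2 p.1.2 p.2)};
  (* jointly smooth for positive times only, as usual for parabolic equations *)
  sf_smooth : smooth_on M
      [set p : R * E * R * R | 0 < p.1.1.1 /\ Dom p.1.1.1 p.1.1.2 p.1.2 p.2]
      (fun p : R * E * R * R => Phi p.1.1.1 p.1.1.2 p.1.2 p.2);
  sf_equivariant : forall A t u lam mu, SO3 A -> Dom t u lam mu ->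
    Dom t (turn A u) lam mu /\ Phi t (turn A u) lam mu = turn A (Phi t u lam mu)
}.

Definition trivial_isotropy u : Prop :=
  forall A, SO3 A -> turn A u = u -> A = 1%:M.

Definition in_relative_equilibrium u lam mu : Prop :=
  forall t, 0 <= t ->
    Dom t u lam mu /\ exists2 A, SO3 A & Phi t u lam mu = turn A u.

Definition is_equilibrium u lam mu : Prop :=
  forall t, 0 <= t -> Dom t u lam mu /\ Phi t u lam mu = u.

(* The orbit returns to its group orbit for the first time at time T. *)
Definition first_relative_return u lam mu (T : R) : Prop :=
  [/\ 0 < T, Dom T u lam mu,
      (forall t A, 0 < t < T -> SO3 A -> Phi t u lam mu <> turn A u) &
      ~ in_relative_equilibrium u lam mu].

(* modulated rotating wave with primary frequency vector [axial X] *)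
Definition modulated_rotating_wave u lam mu (T : R) (X : 'M[R]_3) : Prop :=
  [/\ trivial_isotropy u,
      so3 X,
      first_relative_return u lam mu T,
      Phi T u lam mu = turn (expmx (T *: X)) u &
      forall l : int, rnorm X * T <> 2 * l%:~R * pi].

Definition periodic_solution u lam mu (T : R) : Prop :=
  [/\ trivial_isotropy u, first_relative_return u lam mu T &
      Phi T u lam mu = u].

(* u lies on a modulated rotating wave or periodic solution with (relative)
   period T, and [axial X] is one of its primary frequency vectors *)
Definition primary_frequency_vector u lam mu (T : R) (X : 'M[R]_3) : Prop :=
  modulated_rotating_wave u lam mu T X \/
  [/\ periodic_solution u lam mu T, so3 X &
      exists l : int, rnorm X = 2 * l%:~R * pi / T].

Definition orbitally_stable u lam mu : Prop :=
  let O := [set w : E | exists A t,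
              [/\ SO3 A, 0 <= t, Dom t u lam mu & w = turn A (Phi t u lam mu)]] in
  forall e : R, 0 < e -> exists2 d : R, 0 < d &
    forall v w, O w -> `|v - w| < d ->
      forall t, 0 <= t ->
        Dom t v lam mu /\ exists2 w', O w' & `|Phi t v lam mu - w'| < e.

Variables (u0 : E) (X0 : 'M[R]_3).

Record relative_equilibrium_u0 : Prop := {
  re_isotropy : trivial_isotropy u0;
  re_so3 : so3 X0;
  re_neq0 : X0 <> 0;
  re_rotating : forall t, 0 <= t ->
    Dom t u0 0 0 /\ Phi t u0 0 0 = turn (expmx (t *: X0)) u0;
  re_nonequilibrium : ~ is_equilibrium u0 0 0
}.

(* g = L f, L = D_diff Delta_S + D_u F(u0, 0, 0) - X0 as an operator in Y *)
Definition is_L (f g : sfield R N) : Prop :=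
  in_Y S g /\
  exists h1 h2 : sfield R N, [/\ is_DLap S f h1, is_infgen S X0 f h2 &
    eqY S g (fun x =>
      h1 x + 'd (fun w => reaction S (w, 0, 0)) (rep u0 x) (f x) - h2 x)].

(* u + iv = (z - L)^-1 (f + ig), in real and imaginary parts *)
Definition is_resolvent (z : R[i]) (f g u v : sfield R N) : Prop :=
  let a := complex.Re z in let b := complex.Im z in
  exists Lu Lv : sfield R N, [/\ is_L u Lu, is_L v Lv,
    eqY S (fun x => a *: u x - b *: v x - Lu x) f &
    eqY S (fun x => b *: u x + a *: v x - Lv x) g].

Definition resolvent_set : set R[i] := [set z |
  (forall u v : sfield R N, is_resolvent z (fun=> 0) (fun=> 0) u v ->
     normY S u = 0 /\ normY S v = 0) /\
  exists C : R, forall f g : sfield R N, in_Y S f -> in_Y S g ->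
    exists u v : sfield R N, is_resolvent z f g u v /\
      normY S u + normY S v <= C * (normY S f + normY S g)].

Definition spectrum : set R[i] := ~` resolvent_set.

(* P is the Riesz projection (2 pi i)^-1 \oint (z - L)^-1 dz of the part of the
   spectrum in Re z >= 0, over a circle of centre c (on the real line) and
   radius rho separating it from the rest; the integral is taken weakly.  Such a
   circle exists when the part in Re z >= 0 is bounded and the rest is at
   positive distance of the imaginary axis.  For real f the integral is real
   since the circle is symmetric. *)
Definition spectral_projection (P : sfield R N -> sfield R N) : Prop :=
  exists c rho : R,
    let dist2 (z : R[i]) := (complex.Re z - c) ^+ 2 + (complex.Im z) ^+ 2 in
    [/\ 0 < rho,
        (forall z, spectrum z -> 0 <= complex.Re z -> dist2 z < rho ^+ 2),
        (forall z, spectrum z -> complex.Re z < 0 -> rho ^+ 2 < dist2 z) &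
        forall f, in_Y S f -> in_Y S (P f) /\
          forall u v : R -> sfield R N,
            (forall th, 0 <= th <= 2 * pi ->
               is_resolvent (Complex (c + rho * cos th) (rho * sin th))
                 f (fun=> 0) (u th) (v th)) ->
            forall g, in_Y S g ->
              ipY S (P f) g = (2 * pi)^-1 *
                Rintegral lebesgue_measure `[0, 2 * pi]
                  (fun th => rho * (cos th * ipY S (u th) g
                                    - sin th * ipY S (v th) g))].

(* T t = exp(L t): the strongly continuous semigroup in Y generated by L *)
Record generated_semigroup (T : R -> sfield R N -> sfield R N) : Prop := {
  sg_in : forall t f, 0 <= t -> in_Y S f -> in_Y S (T t f);
  sg_linear : forall t c f g, 0 <= t -> in_Y S f -> in_Y S g ->
    eqY S (T t (fun x => c *: f x + g x)) (fun x => c *: T t f x + T t g x);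
  sg_bounded : forall t, 0 <= t -> exists C : R, forall f, in_Y S f ->
    normY S (T t f) <= C * normY S f;
  sg_zero : forall f, in_Y S f -> eqY S (T 0 f) f;
  sg_add : forall s t f, 0 <= s -> 0 <= t -> in_Y S f ->
    eqY S (T (s + t) f) (T s (T t f));
  sg_continuous : forall f, in_Y S f ->
    normY S (fun x => T t f x - f x) @[t --> 0^'+] --> (0 : R);
  sg_generator : forall f g, is_L f g <->
    [/\ in_Y S f, in_Y S g &
        normY S (fun x => t^-1 *: (T t f x - f x) - g x) @[t --> 0^'+]
          --> (0 : R)]
}.

Record spectral_hypothesis (P : sfield R N -> sfield R N) : Prop := {
  sp_projection : spectral_projection P;
  sp_dim : exists b : 'I_5 -> sfield R N,
    [/\ (forall i, in_Y S (b i) /\ eqY S (P (b i)) (b i)),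
        (forall c : 'I_5 -> R,
           eqY S (fun x => \sum_i c i *: b i x) (fun=> 0) -> forall i, c i = 0) &
        forall f, in_Y S f -> exists c : 'I_5 -> R,
          eqY S (P f) (fun x => \sum_i c i *: b i x)];
  sp_decay : exists2 T : R -> sfield R N -> sfield R N, generated_semigroup T &
    exists C beta0 : R, [/\ 0 < C, 0 < beta0 &
      forall t f, 0 <= t -> in_Y S f ->
        let g := fun x => f x - P f x in
        normY S (T t g) <= C * expR (- (beta0 * t)) * normY S g]
}.

(* V_*: the orthogonal complement of the tangent space of the group orbit of u0
   in the range of P; the range of P is contained in the domain of L, hence in
   Y^alpha. *)
Definition Vstar (P : sfield R N -> sfield R N) : set E := [set v |
  eqY S (P (rep v)) (rep v) /\
  forall Y h, so3 Y -> is_infgen S Y (rep u0) h -> ipY S (rep v) h = 0].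

Variables (V : set E) (Psi : E -> R -> R -> E).
Variables (XG : E -> R -> R -> 'M[R]_3) (XN : E -> R -> R -> E).

Definition reduced_solution (A : R -> 'M[R]_3) (q : R -> E) (tau lam mu : R)
    : Prop :=
  [/\ {within `[0, tau], continuous A}, {within `[0, tau], continuous q} &
      forall t, 0 < t < tau ->
        is_derive t 1 A (A t *m XG (q t) lam mu) /\
        is_derive t 1 q (XN (q t) lam mu)].

(* eta: size of the neighbourhood of 0 in V_* parametrizing the manifold;
   del: size of the parameters.  Psi is allowed to depend on the parameters. *)
Record center_manifold (M : nat) (eta del : R) : Prop := {
  cm_center : Psi 0 0 0 = u0;
  cm_chart : smooth_on M
    [set p : E * R * R | [/\ V p.1.1, `|p.1.1| < eta, `|p.1.2| < del
                           & `|p.2| < del]]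
    (fun p : E * R * R => Psi p.1.1 p.1.2 p.2);
  cm_diffeo : forall lam mu, `|lam| < del -> `|mu| < del ->
    diffeo_onto_image M
      [set p : 'M[R]_3 * E | [/\ SO3 p.1, V p.2 & `|p.2| < eta]]
      (fun p : 'M[R]_3 * E => turn p.1 (Psi p.2 lam mu));
  cm_XG_smooth : smooth_on M [set p : E * R * R | V p.1.1]
    (fun p : E * R * R => XG p.1.1 p.1.2 p.2);
  cm_XN_smooth : smooth_on M [set p : E * R * R | V p.1.1]
    (fun p : E * R * R => XN p.1.1 p.1.2 p.2);
  cm_XG_so3 : forall q lam mu, V q -> so3 (XG q lam mu);
  cm_XN_V : forall q lam mu, V q -> V (XN q lam mu);
  cm_XG0 : XG 0 0 0 = X0;
  cm_XN0 : XN 0 0 0 = 0;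
  cm_reduction : forall (A : R -> 'M[R]_3) (q : R -> E) (tau lam mu : R),
    `|lam| < del -> `|mu| < del -> 0 <= tau ->
    (forall t, 0 <= t <= tau -> [/\ SO3 (A t), V (q t) & `|q t| < eta]) ->
    (reduced_solution A q tau lam mu <->
     forall t, 0 <= t <= tau ->
       let u := turn (A 0) (Psi (q 0) lam mu) in
       Dom t u lam mu /\
       Phi t u lam mu = turn (A t) (Psi (q t) lam mu))
}.

(* z is an eigenvalue of the complexification of the linear map B on V *)
Definition eigenvalue_on (B : E -> E) (z : R[i]) : Prop :=
  let a := complex.Re z in let b := complex.Im z in
  exists v w, [/\ V v, V w, ~ (v = 0 /\ w = 0),
                  B v = a *: v - b *: w & B w = b *: v + a *: w].

Definition stable_periodic_orbit (q : R -> E) (T eta lam mu : R) : Prop :=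
  [/\ 0 < T, (forall t, is_derive t 1 q (XN (q t) lam mu)),
      (forall t, q (t + T) = q t), (forall t, 0 < t < T -> q t <> q 0) &
      forall e : R, 0 < e -> exists2 d : R, 0 < d &
        forall (p : R -> E) (tau s : R),
          {within `[0, tau], continuous p} ->
          (forall t, 0 <= t <= tau -> V (p t) /\ `|p t| < eta) ->
          (forall t, 0 < t < tau -> is_derive t 1 p (XN (p t) lam mu)) ->
          `|p 0 - q s| < d ->
          forall t, 0 <= t <= tau -> exists s', `|p t - q s'| < e].

Variables (omega_bif : R) (omega : R -> R -> R) (q r : R -> R -> R -> E).

Definition period (lam mu : R) : R := 2 * pi / `|omega lam mu|.

Record hopf_bifurcation (M : nat) (eta del : R) : Prop := {
  hb_trivial : forall lam mu, `|lam| < del -> `|mu| < del -> XN 0 lam mu = 0;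
  hb_omega_bif : omega_bif <> 0;
  hb_eigenvalues : exists al be : R -> R -> R,
    [/\ Ck M [set p : R * R | `|p.1| < del /\ `|p.2| < del]
          (fun p : R * R => al p.1 p.2) /\
        Ck M [set p : R * R | `|p.1| < del /\ `|p.2| < del]
          (fun p : R * R => be p.1 p.2),
        al 0 0 = 0 /\ be 0 0 = 0,
        0 < derive1 (fun lam : R => al lam 0) 0,
        (forall lam mu, `|lam| < del -> `|mu| < del ->
           (al lam mu = 0 <-> lam = 0)) &
        forall lam mu, `|lam| < del -> `|mu| < del ->
          let B := fun v => 'D_v (fun w => XN w lam mu) 0 in
          let b := omega_bif + be lam mu in
          eigenvalue_on B (Complex (al lam mu) b) /\
          eigenvalue_on B (Complex (al lam mu) (- b))];
  hb_omega : exists (h : R -> R) (s : R -> R -> R),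
    [/\ Ck M [set mu : R | `|mu| < del] h,
        exists C : R, forall mu, `|mu| < del -> `|h mu| <= C * `|mu|,
        CS M [set mu : R | `|mu| < del] del (fun mu lam => s lam mu) &
        forall lam mu, 0 <= lam < del -> `|mu| < del ->
          omega lam mu <> 0 /\
          omega lam mu = omega_bif + h mu + lam * s lam mu];
  hb_orbit : forall t lam mu, 0 <= lam < del -> `|mu| < del ->
    [/\ V (q t lam mu), `|q t lam mu| < eta &
        q t lam mu = Num.sqrt lam *: r t lam mu];
  hb_CS_r : CS M [set p : R * R | `|p.2| < del] del
              (fun p lam => r p.1 lam p.2);
  hb_CS_q : CS M [set p : R * R | `|p.2| < del] del
              (fun p lam => q p.1 lam p.2);
  hb_stable : forall lam mu, 0 < lam < del -> `|mu| < del ->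
    stable_periodic_orbit (fun t => q t lam mu) (period lam mu) eta lam mu
}.

Variables (A : R -> R -> R -> 'M[R]_3) (X : R -> R -> 'M[R]_3).

Definition branch_point (lam mu : R) : E := Psi (q 0 lam mu) lam mu.

Record bifurcating_branch (M : nat) (del : R) : Prop := {
  bb_A0 : forall lam mu, 0 <= lam < del -> `|mu| < del -> A 0 lam mu = 1%:M;
  bb_SO3 : forall t lam mu, 0 <= lam < del -> `|mu| < del -> SO3 (A t lam mu);
  bb_ode : forall t lam mu, 0 <= lam < del -> `|mu| < del ->
    is_derive t 1 (fun s => A s lam mu)
      (A t lam mu *m XG (q t lam mu) lam mu);
  bb_CS_A : CS M [set p : R * R | `|p.2| < del] del
              (fun p lam => A p.1 lam p.2);
  bb_Phi : forall t lam mu, 0 <= t -> 0 <= lam < del -> `|mu| < del ->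
    Dom t (branch_point lam mu) lam mu /\
    Phi t (branch_point lam mu) lam mu =
      turn (A t lam mu) (Psi (q t lam mu) lam mu);
  bb_CS_Phi : CS M [set p : R * R | 0 <= p.1 /\ `|p.2| < del] del
    (fun p lam => Phi p.1 (branch_point lam p.2) lam p.2);
  bb_lam0 : forall t mu, 0 <= t -> `|mu| < del ->
    Phi t (branch_point 0 mu) 0 mu =
      turn (expmx (t *: XG 0 0 mu)) (branch_point 0 mu);
  bb_X_so3 : forall lam mu, 0 <= lam < del -> `|mu| < del -> so3 (X lam mu);
  bb_X : forall lam mu, 0 <= lam < del -> `|mu| < del ->
    A (period lam mu) lam mu = expmx (period lam mu *: X lam mu);
  bb_X_qD : CS_qD M [set mu : R | `|mu| < del] del X0
    (fun mu lam => period lam mu *: X lam mu);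
  bb_stable : forall lam mu, 0 < lam < del -> `|mu| < del ->
    orbitally_stable (branch_point lam mu) lam mu;
  bb_frequency : forall lam mu, 0 < lam < del -> `|mu| < del ->
    primary_frequency_vector (branch_point lam mu) lam mu (period lam mu)
      (X lam mu)
}.

End Semiflow.

Definition adapted_basis (R : realType) (X0 X01 X1 X2 : 'M[R]_3) : Prop :=
  [/\ X01 = (rnorm X0)^-1 *: X0 /\ so3 X1 /\ so3 X2,
      dotv (axial X01) (axial X1) = 0 /\ dotv (axial X01) (axial X2) = 0 /\
        dotv (axial X1) (axial X2) = 0,
      rnorm X01 = 1 /\ rnorm X1 = 1 /\ rnorm X2 = 1 &
      bracket X01 X1 = X2 /\ bracket X1 X2 = X01 /\ bracket X2 X01 = X1].

(* Main.v *)
Require Import Defs.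
From HB Require Import structures.
From mathcomp Require Import all_boot all_order all_algebra.
From mathcomp Require Import all_classical all_reals all_analysis.
From mathcomp Require Import complex.
From mathcomp Require Import ring lra.
Set Implicit Arguments.
Unset Strict Implicit.
Unset Printing Implicit Defensive.
Import Order.TTheory GRing.Theory Num.Theory numFieldNormedType.Exports.
Local Open Scope classical_set_scope.
Local Open Scope ring_scope.

(** Along the bifurcating branch the solution returns to its group orbit after
    one period T, turned by A (T) = exp (T X).  At the bifurcation point this
    rotation is the identity, because |X0| T = 2 pi |k|.  Hence A (T) stays
    close to the identity, T X is a multiple of the small logarithm of A (T),
    and X is orthogonal to X0 exactly when the antisymmetric part of A (T) is.
    This part is tested by the Frobenius product <A (T), X0> ([frob]), since the
    symmetric terms 1 and X^2 of Rodrigues' formula are orthogonal to so(3).  The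
    passage from <A (T), X0> = 0 to the orthogonality of the axes is
    [expmx_frob_orthogonal].  It has to exclude the angle pi, where the
    antisymmetric part vanishes; this is done by keeping the trace above -1.

    It remains to solve G (eps, mu) = <A (T), X0> = 0 with lambda = eps^2.  In
    these variables the data extend smoothly to both sides of eps = 0
    ([return_rotation_extension]).  At eps = 0 the periodic solution is the
    trivial one, so A solves the linear equation A' = A X_G (0, 0, mu) and
    A (t) = exp (t X_G (0, 0, mu)) ([linear_ode_rodrigues]).  There

      G (0, mu) = 2 sin (T |X_G|) / |X_G| <X_G, X0>,

    where the last bracket is the Euclidean product of the axes.  As T |X_G| is
    a multiple of 2 pi at mu = 0, only the derivative of this angle survives,
    and dG/dmu (0, 0) is a nonzero multiple of x0' - k omega'
    ([return_rotation_derive]).  The hypothesis says that it does not vanish,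
    and the implicit function theorem ([implicit_function]) gives
    mu = phi (eps), of the same class C^m as the data; the curve is
    mu (lambda) = phi (sqrt lambda).

    Orbital stability and the frequency vector are those of the branch.  When
    X <> 0 the solution is not periodic: elements of q(D) have norm less than
    2 pi, whereas a periodic solution has |X| T in 2 pi Z. *)

(** * Calculus of maps of class C^k *)

Section CkCalculus.
Variable R : realType.
Implicit Types E F G : normedModType R.

Lemma differential_eps E F (f : E -> F) x : differentiable f x ->
  forall e : R, 0 < e ->
  \forall h \near (0 : E), `|f (h + x) - f x - 'd f x h| <= e * `|h|.
Proof.
move=> /diff_locally /eqaddoP df e e0; apply: filterS (df e e0) => h.
by rewrite -addrA -opprD.
Qed.

(** The differential is a chosen linear map; its defining estimate determines
    it. *)
Lemma is_diff_eps E F (f : E -> F) (L : {linear E -> F}) x : continuous L ->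
  (forall e : R, 0 < e ->
     \forall h \near (0 : E), `|f (h + x) - f x - L h| <= e * `|h|) ->
  is_diff x f L.
Proof.
move=> cL df.
have fL : f \o shift x = cst (f x) + L +o_ (0 : E) id.
  apply/eqaddoP => e e0; apply: filterS (df e e0) => h.
  by rewrite -addrA -opprD.
have dL := diff_unique cL fL.
by apply: DiffDef => //; apply/diff_locallyP; rewrite dL.
Qed.

Lemma near_eq_is_diff E F (f g : E -> F) x :
  (\forall y \near x, f y = g y) -> differentiable f x -> is_diff x g ('d f x).
Proof.
move=> fg df; apply: is_diff_eps => [|e e0]; first exact: diff_continuous.
have fg0 : \forall h \near (0 : E), f (h + x) = g (h + x).
  by move: fg; rewrite (near_shift 0) subr0.
rewrite -(nbhs_singleton fg); near=> h.
rewrite -(near fg0 h)//; near: h; exact: differential_eps.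
Unshelve. all: by end_near. Qed.

Lemma openXT E F (U : set E) : open U -> open (U `*` [set: F]).
Proof.
move=> oU; rewrite openE => -[x y] [/= Ux _]; rewrite /interior.
apply: (@filterS _ (nbhs (x, y)) _ (fst @^-1` U)); first by move=> p Up; split.
by apply: cvg_fst; apply: open_nbhs_nbhs.
Qed.

Lemma Ck_eq k E F (U : set E) (f g : E -> F) : open U ->
  (forall x, U x -> f x = g x) -> Ck k U f -> Ck k U g.
Proof.
elim: k E F U f g => [|k IH] E F U f g oU fg /=.
  move=> cf x Ux; have nfg : \forall y \near x, f y = g y.
    by near=> y; apply: fg; near: y; exact: open_nbhs_nbhs.
  have gfx : f @ x --> g x by rewrite -(fg x Ux); exact: cf.
  exact: cvg_trans (near_eq_cvg nfg) gfx.
move=> [df Tf].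
have fg_diff x : U x -> is_diff x g ('d f x).
  move=> Ux; apply: near_eq_is_diff (df x Ux).
  by near=> y; apply: fg; near: y; exact: open_nbhs_nbhs.
split=> [x Ux|]; first by have := fg_diff x Ux => ?.
apply: IH Tf; first exact: openXT.
by move=> [x v] [/= Ux _]; have := fg_diff x Ux => ?; rewrite diff_val.
Unshelve. all: by end_near. Qed.

Lemma Ck_sub k E F (U V : set E) (f : E -> F) :
  U `<=` V -> Ck k V f -> Ck k U f.
Proof.
elim: k E F U V f => [|k IH] E F U V f UV /=; first by move=> cf x /UV/cf.
move=> [df Tf]; split=> [x /UV/df//|]; apply: IH Tf.
by move=> [x v] [/= /UV].
Qed.

Lemma Ck_differentiable k E F (U : set E) (f : E -> F) x :
  Ck k.+1 U f -> U x -> differentiable f x.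
Proof. by move=> [df _] /df. Qed.

Lemma CkS k E F (U : set E) (f : E -> F) : Ck k.+1 U f -> Ck k U f.
Proof.
elim: k E F U f => [|k IH] E F U f [df Tf].
  by move=> x /df; exact: differentiable_continuous.
by split=> //; exact: IH.
Qed.

Lemma Ck_continuous k E F (U : set E) (f : E -> F) x :
  Ck k U f -> U x -> {for x, continuous f}.
Proof.
by elim: k => [|k IH] Cf Ux; [exact: Cf|exact: IH (CkS Cf) Ux].
Qed.

Lemma Ck_le k j E F (U : set E) (f : E -> F) :
  (j <= k)%N -> Ck k U f -> Ck j U f.
Proof.
move=> /subnK <-; elim: (k - j)%N => // i IH; rewrite addSn => /CkS; exact: IH.
Qed.

Lemma Ck_lin k E F (U : set E) (f : {linear E -> F}) :
  continuous f -> Ck k U f.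
Proof.
elim: k E F U f => [|k IH] E F U f cf /=; first by move=> x _; exact: cf.
split=> [x _|]; first exact: linear_differentiable.
pose f2 (p : E * E) := f p.2.
have lin2 : linear f2 by move=> a p q; rewrite /f2 /= linearP.
pose f2M := GRing.isLinear.Build _ _ _ _ _ lin2.
pose f2L : {linear (E * E)%type -> F}
    := HB.pack f2 f2M.
have -> : (fun p : E * E => 'd f (p.1) (p.2)) = f2L.
  by apply/funext => -[x v] /=; rewrite diff_lin.
by apply: IH => -[x v]; apply: (cvg_comp snd f _ (cf v)); exact: cvg_snd.
Qed.

Lemma Ck_fst k E F (U : set (E * F)) : Ck k U fst.
Proof. by apply: Ck_lin => x; exact: cvg_fst. Qed.

Lemma Ck_snd k E F (U : set (E * F)) : Ck k U snd.
Proof. by apply: Ck_lin => x; exact: cvg_snd. Qed.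

Lemma Ck_cst k E F (U : set E) (c : F) : Ck k U (fun=> c).
Proof.
elim: k E F U c => [|k IH] E F U c /=; first by move=> x _; exact: cvg_cst.
split=> [x _|]; first exact: differentiable_cst.
have -> : (fun p : E * E => 'd (fun=> c) (p.1) (p.2)) = (fun=> 0).
  by apply/funext => -[x v] /=; rewrite (diff_cst c x).
exact: IH.
Qed.

Lemma Ck_pair k E F G (U : set E) (f : E -> F) (g : E -> G) : open U ->
  Ck k U f -> Ck k U g -> Ck k U (fun x => (f x, g x)).
Proof.
elim: k E F G U f g => [|k IH] E F G U f g oU /=.
  by move=> cf cg x Ux; apply: cvg_pair; [exact: cf|exact: cg].
move=> [df Tf] [dg Tg]; split=> [x Ux|].
  by apply: differentiable_pair; [exact: df|exact: dg].
apply: Ck_eq (IH _ _ _ _ _ _ _ Tf Tg); [exact: openXT| |exact: openXT].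
move=> [x v] [/= Ux _]; rewrite diff_pair//; [exact: df|exact: dg].
Qed.

(** The tangent map of a composite is the composite of the tangent maps, which
    is what makes the recursive definition by tangent maps convenient: the
    inductive step is the induction hypothesis at the level of tangent maps. *)
Lemma Ck_comp k E F G (U : set E) (V : set F) (f : E -> F) (g : F -> G) :
  open U -> (forall x, U x -> V (f x)) -> Ck k U f -> Ck k V g ->
  Ck k U (g \o f).
Proof.
elim: k E F G U V f g => [|k IH] E F G U V f g oU UV.
  by move=> cf cg x Ux; apply: continuous_comp; [exact: cf|exact/cg/UV].
move=> Cf Cg; have [df Tf] := Cf; have [dg Tg] := Cg; split=> [x Ux|].
  by apply: differentiable_comp; [exact: df|exact/dg/UV].
have oUT := @openXT E E U oU.
apply: (@Ck_eq k _ _ _ ((fun p => 'd g (p.1) (p.2))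
    \o (fun p : E * E => (f p.1, 'd f (p.1) (p.2))))) => //.
  move=> [x v] [/= Ux _]; rewrite (diff_comp (df x Ux))//; exact/dg/UV.
apply: (IH _ _ _ _ (V `*` [set: F])) => //.
  by move=> [x v] [/= Ux _]; split=> //=; exact: UV.
apply: Ck_pair => //; apply: (IH _ _ _ _ U) => //.
- by move=> x [].
- exact: Ck_fst.
- exact: CkS.
Qed.

Lemma Ck_add k E F (U : set E) (f g : E -> F) : open U ->
  Ck k U f -> Ck k U g -> Ck k U (fun x => f x + g x).
Proof.
elim: k E F U f g => [|k IH] E F U f g oU /=.
  by move=> cf cg x Ux; apply: cvgD; [exact: cf|exact: cg].
move=> [df Tf] [dg Tg]; split=> [x Ux|].
  by apply: differentiableD; [exact: df|exact: dg].
apply: Ck_eq (IH _ _ _ _ _ _ Tf Tg); [exact: openXT| |exact: openXT].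
move=> [x v] [/= Ux _].
exact: esym (congr1 (fun L => L v) (diffD (df x Ux) (dg x Ux))).
Qed.

Lemma Ck_mul k E (U : set E) (f g : E -> R) : open U ->
  Ck k U f -> Ck k U g -> Ck k U (fun x => f x * g x).
Proof.
elim: k E U f g => [|k IH] E U f g oU.
  by move=> cf cg x Ux; apply: cvgM; [exact: cf|exact: cg].
move=> Cf Cg; have [df Tf] := Cf; have [dg Tg] := Cg; split=> [x Ux|].
  by apply: differentiableM; [exact: df|exact: dg].
have oUT := @openXT E E U oU.
have fstC (h : E -> R) : Ck k.+1 U h -> Ck k (U `*` [set: E]) (h \o fst).
  move=> /CkS Ch; apply: (Ck_comp _ _ _ Ch) => //; first by move=> p [].
  exact: Ck_fst.
have := Ck_add oUT (IH _ _ _ _ oUT (fstC f Cf) Tg)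
  (IH _ _ _ _ oUT (fstC g Cg) Tf).
apply: Ck_eq => //.
move=> [x v] [/= Ux _].
exact: esym (congr1 (fun L => L v) (diffM (df x Ux) (dg x Ux))).
Qed.

Lemma Ck_inv k E (U : set E) (f : E -> R) : open U ->
  (forall x, U x -> f x != 0) -> Ck k U f -> Ck k U (fun x => (f x)^-1).
Proof.
elim: k E U f => [|k IH] E U f oU f0.
  by move=> cf x Ux; apply: cvgV; [exact: f0|exact: cf].
move=> Cf; have [df Tf] := Cf; split=> [x Ux|].
  by apply: differentiableV; [exact: df|exact: f0].
have oUT := @openXT E E U oU.
have Cv : Ck k (U `*` [set: E]) (fun p => (f p.1)^-1).
  apply: (@Ck_comp k _ _ _ _ U fst (fun x => (f x)^-1)) => //.
  - by move=> p [].
  - exact: Ck_fst.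
  - exact: IH (CkS Cf).
have C1 : Ck k (U `*` [set: E]) (fun=> -1 : R) by exact: Ck_cst.
have := Ck_mul oUT (Ck_mul oUT C1 (Ck_mul oUT Cv Cv)) Tf.
apply: Ck_eq => //.
move=> [x v] [/= Ux _].
apply: etrans _ (esym (congr1 (fun L => L v) (diffV (df x Ux) (f0 x Ux)))).
by rewrite /= -invfM -expr2 mulN1r.
Qed.

End CkCalculus.

(** * The implicit function theorem for one real unknown *)

Section ImplicitFunction.
Variable R : realType.
Implicit Types E F : normedModType R.

Lemma cvg_pair_nbhs (T : Type) (H : set_system T) (FH : Filter H) E F
    (f : T -> E) (g : T -> F) (x : E) (y : F) :
  f @ H --> x -> g @ H --> y -> (fun t => (f t, g t)) @ H --> (x, y).
Proof. by move=> fx gy; apply: (cvg_pair (f := f) (g := g)). Qed.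

Lemma is_diff_is_derive E F (f df : E -> F) x v :
  is_diff x f df -> is_derive x v f (df v).
Proof.
move=> dfx; apply: DeriveDef; first exact: diff_derivable.
by rewrite deriveE // diff_val.
Qed.

Lemma is_derive_slice E F (G : E * R -> F) x (y : R) :
  differentiable G (x, y) ->
  is_derive y 1 (fun t => G (x, t)) ('d G (x, y) (0, 1)).
Proof.
move=> dG.
have dxt : is_diff y (fun t : R => (x, t)) (fun h => (0 : E, h)).
  exact: (@is_diff_pair _ _ _ _ (fun=> x) (fun=> 0) id id).
have dGy : is_diff ((fun t : R => (x, t)) y) G ('d G (x, y)).
  exact: differentiableP.
have dGxt := is_diff_comp dxt dGy.
exact: (is_diff_is_derive (1 : R) dGxt).
Qed.

(** With L = dG (x, phi x) and D = L (0, 1), the increment kappa of phi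
    satisfies L (h, 0) + D kappa = o (|h| + |kappa|).  For a first choice of the
    error this bounds kappa by C |h|; then the error is o (|h|), which is the
    differentiability of phi. *)
Lemma implicit_is_diff E (G : E * R -> R) (phi : E -> R) x :
  {for x, continuous phi} -> differentiable G (x, phi x) ->
  (\forall z \near x, G (z, phi z) = 0) ->
  'd G (x, phi x) (0, 1) != 0 ->
  is_diff x phi (fun v => - ('d G (x, phi x) (0, 1))^-1
                          * 'd G (x, phi x) (v, 0)).
Proof.
move=> cphi dG G0; set L := 'd G (x, phi x); set D := L (0, 1) => D0.
pose f v := - D^-1 * L (v, 0).
have lf : linear f.
  move=> c u v; rewrite /f.
  have -> : (c *: u + v, 0) = c *: (u, 0) + (v, 0) :> E * R.
    by congr (_, _); rewrite /= scaler0 addr0.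
  by rewrite linearP mulrDr; congr (_ + _); exact: mulrCA.
pose fM := GRing.isLinear.Build _ _ _ _ _ lf.
pose fL : {linear E -> R} := HB.pack f fM.
have [M M0 LM] := @linear_lipschitz _ _ _ L (diff_continuous dG).
have Mf h : `|L (h, 0)| <= M * `|h|.
  apply: le_trans (LM _) _; rewrite ler_pM2l//.
  by rewrite prod_normE/= normr0 ge_max lexx normr_ge0.
have LE h (t : R) : L (h, t) = L (h, 0) + t * D.
  have -> : (h, t) = (h, 0) + t *: (0, 1) :> E * R.
    by congr (_, _); rewrite /= ?scaler0 ?addr0// add0r /GRing.scale /= mulr1.
  by rewrite linearD linearZ.
have DN : 0 < `|D| by rewrite normr_gt0.
suff : is_diff x phi fL by [].
apply: is_diff_eps.
  move=> v; have cL : {for (v, 0), continuous L} by exact: diff_continuous.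
  have cL0 : (fun w : E => L (w, 0)) @ v --> L (v, 0).
    apply: (cvg_comp (fun w : E => (w, 0 : R)) L _ cL).
    by apply: cvg_pair_nbhs; [exact: cvg_id|exact: cvg_cst].
  exact: cvgM (cvg_cst _) cL0.
move=> e e0; pose C := 2 * M / `|D| + 1.
have C0 : 0 <= C by rewrite addr_ge0// divr_ge0// mulr_ge0// ltW.
pose e' := Num.min (`|D| / 2) (e * `|D| / (1 + C)).
have C1 : 0 < 1 + C by rewrite ltr_pwDl.
have e'0 : 0 < e' by rewrite lt_min !divr_gt0// mulr_gt0.
have kap : (fun h => (h, phi (h + x) - phi x)) @ (0 : E) --> (0 : E * R).
  apply: cvg_pair_nbhs; first exact: cvg_id.
  have c1 : (fun h => h + x) @ (0 : E) --> x.
    have : (fun h => h + x) @ (0 : E) --> 0 + x.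
      by apply: cvgD; [exact: cvg_id|exact: cvg_cst].
    by rewrite add0r.
  have : (fun h => phi (h + x) - phi x) @ (0 : E) --> phi x - phi x.
    apply: cvgB; last exact: cvg_cst.
    exact: (cvg_comp (fun h => h + x) phi c1 cphi).
  by rewrite subrr.
have G0' : \forall h \near (0 : E), G (h + x, phi (h + x)) = 0.
  by move: G0; rewrite (near_shift 0) subr0.
have Gx : G (x, phi x) = 0 by exact: nbhs_singleton G0.
have kh : \forall h \near (0 : E),
    `|G ((h, phi (h + x) - phi x) + (x, phi x)) - G (x, phi x)
      - L (h, phi (h + x) - phi x)| <= e' * `|(h, phi (h + x) - phi x)|.
  exact: kap (differential_eps dG e'0).
apply: filter_app kh; near=> h.
set t := phi (h + x) - phi x.
have -> : (h, t) + (x, phi x) = (h + x, phi (h + x)) :> E * R.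
  by congr (_, _); rewrite /t /= subrK.
rewrite (near G0' h)// Gx subrr sub0r normrN -/L LE prod_normE /= => key.
have key2 : `|L (h, 0) + t * D| <= e' * (`|h| + `|t|).
  apply: le_trans key _; rewrite ler_pM2l//.
  by rewrite ge_max lerDl lerDr !normr_ge0.
have tC : `|t| <= C * `|h|.
  have h1 : `|t| * `|D| <= M * `|h| + `|D| / 2 * (`|h| + `|t|).
    rewrite -normrM; have -> : t * D = (L (h, 0) + t * D) - L (h, 0).
      by rewrite addrAC subrr add0r.
    apply: le_trans (ler_normB _ _) _; rewrite addrC lerD//.
    by apply: le_trans key2 _; rewrite ler_wpM2r ?addr_ge0// ge_min lexx.
  rewrite -(ler_pM2r DN) /C.
  have -> : (2 * M / `|D| + 1) * `|h| * `|D| = 2 * M * `|h| + `|h| * `|D|.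
    by field; rewrite lt0r_neq0.
  by lra.
have -> : t - fL h = D^-1 * (L (h, 0) + t * D).
  by rewrite /fL /= /f; field.
rewrite normrM normfV ler_pdivrMl//.
apply: le_trans key2 _.
apply: (@le_trans _ _ (e * `|D| / (1 + C) * ((1 + C) * `|h|))).
  apply: ler_pM; rewrite ?addr_ge0// ?(ltW e'0)//; last by lra.
  by rewrite ge_min lexx orbT.
rewrite le_eqVlt; apply/orP; left; apply/eqP; field.
by rewrite lt0r_neq0.
Unshelve. all: by end_near. Qed.

(** The formula phi'(x) v = - (dG/dy)^-1 dG (v, 0) expresses the tangent map of
    phi through phi and the tangent map of G, so each order of regularity of
    phi yields the next one, until that of G is reached. *)
Lemma implicit_Ck k E (U : set E) (W : set (E * R)) (G : E * R -> R)
    (phi : E -> R) : open U ->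
  (forall x, U x -> {for x, continuous phi}) -> Ck k.+1 W G ->
  (forall x, U x -> [/\ W (x, phi x), G (x, phi x) = 0 &
                        'd G (x, phi x) (0, 1) != 0]) ->
  Ck k.+1 U phi.
Proof.
move=> oU cphi CG Gphi; have [dG TG] := CG.
have dphi x : U x -> is_diff x phi (fun v => - ('d G (x, phi x) (0, 1))^-1
                          * 'd G (x, phi x) (v, 0)).
  move=> Ux; have [Wx _ D0] := Gphi x Ux.
  apply: implicit_is_diff => //; [exact: cphi|exact: dG|].
  by near=> z; have [|] // := Gphi z; near: z; exact: open_nbhs_nbhs.
suff: forall j, (j <= k.+1)%N -> Ck j U phi by apply.
elim=> [_|j IH jk]; first exact: cphi.
have Cphi := IH (ltnW jk); split.
  by move=> x Ux; have dx := dphi x Ux; exact: ex_diff.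
pose TGv (w : E * E -> E * R) (p : E * E) := 'd G (p.1, phi p.1) (w p).
have oUT := @openXT _ E E U oU.
have CTG (w : E * E -> E * R) : Ck j (U `*` [set: E]) w ->
    Ck j (U `*` [set: E]) (TGv w).
  move=> Cw; pose f2 (p : E * E) := ((p.1, phi p.1), w p).
  apply: (@Ck_comp R j _ _ _ _ (W `*` [set: E * R]) f2
    (fun q => 'd G (q.1) (q.2))) => //.
  - by move=> p [/= /Gphi[]].
  - apply: Ck_pair => //; apply: Ck_pair => //; first exact: Ck_fst.
    apply: (@Ck_comp R j _ _ _ _ U fst phi) => //; first by move=> p [].
    exact: Ck_fst.
  - exact: Ck_le TG.
have C1 : Ck j (U `*` [set: E]) (TGv (fun=> (0, 1))).
  by apply: CTG; exact: Ck_cst.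
have C2 : Ck j (U `*` [set: E]) (TGv (fun p => (p.2, 0))).
  by apply: CTG; apply: Ck_pair => //; [exact: Ck_snd|exact: Ck_cst].
have Cm : Ck j (U `*` [set: E]) (fun=> -1 : R) by exact: Ck_cst.
have Cinv : Ck j (U `*` [set: E]) (fun p => (TGv (fun=> (0, 1)) p)^-1).
  by apply: Ck_inv => // p [/= /Gphi[]].
have := Ck_mul oUT (Ck_mul oUT Cm Cinv) C2.
apply: Ck_eq => // -[x v] [/= Ux _].
rewrite (@diff_val _ _ _ _ _ _ _ (dphi x Ux)) /TGv /=.
by rewrite mulN1r.
Unshelve. all: by end_near. Qed.

(** After division by dG/dy (a, b) the partial derivative is at least 1/2 on a
    box around (a, b).  So G (x, .) is steep there: it changes sign, its zero is
    unique, and the distance of two points is at most twice the difference of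
    the values, which also makes the zero depend continuously on x. *)
Theorem implicit_function k E (W : set (E * R)) (G : E * R -> R) a b :
  open W -> W (a, b) -> Ck k.+1 W G -> G (a, b) = 0 ->
  'd G (a, b) (0, 1) != 0 ->
  exists (d : R) (phi : E -> R),
    [/\ 0 < d, phi a = b, Ck k.+1 (ball a d) phi &
        forall x, ball a d x -> W (x, phi x) /\ G (x, phi x) = 0].
Proof.
move=> oW Wab CG Gab; set D := 'd G (a, b) (0, 1) => D0.
pose g x y := G (x, y) / D.
have [dG TG] := CG.
pose H (p : E * R) := 'd G p (0, 1) / D.
have cH : H @ (a, b) --> (1 : R).
  have cTG : {for ((a, b), (0, 1)), continuous (fun q => 'd G (q.1) (q.2))}.
    by apply: (Ck_continuous TG).
  have cD : (fun p : E * R => 'd G p (0, 1)) @ (a, b) --> D.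
    pose w (p : E * R) := (p, (0, 1) : E * R).
    apply: (cvg_comp w (fun q => 'd G (q.1) (q.2)) _ cTG).
    by apply: cvg_pair_nbhs; [exact: cvg_id|exact: cvg_cst].
  by rewrite -(divff D0); exact: cvgM cD (cvg_cst _).
have H1 : \forall p \near (a, b), 2^-1 < H p.
  by apply: (cvgr_gt (1 : R) cH); lra.
have /nbhs_ballP[rho /= rho0 Hrho] : \forall p \near (a, b), W p /\ 2^-1 < H p.
  near=> p; split; first by near: p; exact: open_nbhs_nbhs.
  by near: p.
have box x (y : R) : ball a rho x -> ball b rho y ->
    W (x, y) /\ 2^-1 < H (x, y).
  by move=> ax bx; apply: Hrho.
have dg x (y : R) : ball a rho x -> ball b rho y ->
    is_derive y 1 (g x) (H (x, y)).
  move=> ax bx; have [Wxy _] := box x y ax bx.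
  have dGy := is_derive_slice (dG _ Wxy).
  have := @is_deriveZ _ _ _ (fun t => G (x, t)) D^-1 y 1 _ dGy.
  have -> : D^-1 \*: (fun t => G (x, t)) = g x.
    by apply/funext => t; rewrite /g mulrC.
  by rewrite /H mulrC.
have steep x (y1 y2 : R) : ball a rho x -> ball b rho y1 -> ball b rho y2 ->
    y1 <= y2 -> (y2 - y1) / 2 <= g x y2 - g x y1.
  move=> ax b1 b2 y12.
  have sub (y : R) : y1 <= y <= y2 -> ball b rho y.
    move=> /andP[y1y yy2]; move: b1 b2; rewrite /ball/= /ball_ !ltr_norml.
    by move=> /andP[? ?] /andP[? ?]; apply/andP; split; lra.
  have [y|//|z] := @MVT_segment R (g x) (fun y => H (x, y)) y1 y2 y12.
  - rewrite in_itv /= => /andP[? ?].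
    by apply: dg => //; apply: sub; rewrite !ltW.
  - apply: derivable_within_continuous => y; rewrite in_itv /= => yy.
    by have := dg x y ax (sub _ yy) => ?.
  - rewrite in_itv /= => zz ->; have [_ hz] := box x z ax (sub _ zz).
    by rewrite mulrC ler_wpM2r ?subr_ge0// ltW.
have steepN x (y1 y2 : R) : ball a rho x -> ball b rho y1 -> ball b rho y2 ->
    `|y2 - y1| <= 2 * `|g x y2 - g x y1|.
  wlog y12 : y1 y2 / y1 <= y2.
    move=> th ax b1 b2; have [/th|/ltW/th] := leP y1 y2; first exact.
    by move=> h; rewrite distrC (distrC (g x y2)); exact: h.
  move=> ax b1 b2; have st := steep _ _ _ ax b1 b2 y12.
  rewrite ger0_norm ?subr_ge0//.
  apply: le_trans (ler_wpM2l _ (ler_norm _)) => //.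
  by lra.
have cg x y : W (x, y) -> {for x, continuous (g ^~ y)}.
  move=> Wxy; apply: cvgM; last exact: cvg_cst.
  apply: (cvg_comp (fun x => (x, y)) G _ (Ck_continuous CG Wxy)).
  by apply: cvg_pair_nbhs; [exact: cvg_id|exact: cvg_cst].
have gab : g a b = 0 by rewrite /g Gab mul0r.
(* On this smaller ball the steepness makes g x change sign between
   b - rho / 2 and b + rho / 2. *)
have /nbhs_ballP[del /= del0 Hdel] : \forall x \near a, `|g x b| < rho / 8.
  have /cvgrPdist_lt : (g ^~ b) @ a --> (0 : R) by rewrite -gab; exact: cg.
  move=> /(_ (rho / 8)); rewrite divr_gt0// => /(_ isT); apply: filterS => x.
  by rewrite sub0r normrN.
pose d := Num.min rho del.
have d0 : 0 < d by rewrite lt_min rho0.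
have dsub x : ball a d x -> ball a rho x /\ `|g x b| < rho / 8.
  move=> ax; split; first by apply: le_ball ax; rewrite ge_min lexx.
  by apply: Hdel; apply: le_ball ax; rewrite ge_min lexx orbT.
pose phi x := xget b [set y | ball b rho y /\ G (x, y) = 0].
have phiP x : ball a d x -> ball b rho (phi x) /\ G (x, phi x) = 0.
  move=> ax; apply: (@xgetPex _ b [set y | ball b rho y /\ G (x, y) = 0]).
  have [axr gxb] := dsub x ax.
  have bb : ball b rho b by exact: ballxx.
  have bp (y : R) : `|b - y| <= rho / 2 -> ball b rho y.
    by move=> by2; rewrite /ball/= /ball_; apply: le_lt_trans by2 _; lra.
  have bpr : ball b rho (b + rho / 2).
    by apply: bp; rewrite opprD addrA subrr sub0r normrN ger0_norm; lra.
  have bmr : ball b rho (b - rho / 2).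
    by apply: bp; rewrite opprB addrCA subrr addr0 ger0_norm; lra.
  have s1 := steep _ _ _ axr bb bpr _.
  have s2 := steep _ _ _ axr bmr bb _.
  have {}s1 := s1 (ltac:(lra)); have {}s2 := s2 (ltac:(lra)).
  move: gxb; rewrite ltr_norml => /andP[g1 g2].
  have [||c cc gc] := @IVT R (g x) (b - rho / 2) (b + rho / 2) 0 (ltac:(lra)).
  - apply: derivable_within_continuous => y; rewrite in_itv /= => /andP[? ?].
    have by' : ball b rho y.
      by apply: bp; rewrite ler_norml; apply/andP; split; lra.
    by have := dg x y axr by' => ?.
  - by rewrite ge_min le_max; apply/andP; split; apply/orP; [left|right]; lra.
  exists c; split.
    move: cc; rewrite in_itv /= => /andP[? ?].
    by apply: bp; rewrite ler_norml; apply/andP; split; lra.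
  by move/eqP: gc; rewrite mulf_eq0 invr_eq0 (negbTE D0) orbF => /eqP.
have phig x : ball a d x -> g x (phi x) = 0.
  by move=> /phiP[_ e]; rewrite /g e mul0r.
have aa : ball a d a by exact: ballxx.
have cphi x : ball a d x -> {for x, continuous phi}.
  move=> ax; have [bx _] := phiP x ax; have [axr _] := dsub x ax.
  have [Wx _] := box _ _ axr bx.
  apply/cvgrPdist_lt => e e0.
  have /cvgrPdist_lt : (g ^~ (phi x)) @ x --> (0 : R).
    by rewrite -(phig x ax); exact: cg.
  move=> /(_ (e / 2)); rewrite divr_gt0// => /(_ isT) Hg.
  have nd : nbhs x (ball a d).
    by apply: open_nbhs_nbhs; split=> //; exact: ball_open.
  near=> z; have az : ball a d z by near: z.
  have [azr _] := dsub z az; have [bz _] := phiP z az.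
  apply: le_lt_trans (steepN z (phi z) (phi x) azr bz bx) _.
  rewrite (phig z az) subr0 mulrC -ltr_pdivlMr//.
  by rewrite -normrN -sub0r; near: z.
have Gphi x : ball a d x ->
    [/\ W (x, phi x), G (x, phi x) = 0 & 'd G (x, phi x) (0, 1) != 0].
  move=> ax; have [bx Gx] := phiP x ax; have [axr _] := dsub x ax.
  have [Wx Hx] := box _ _ axr bx; split; [exact: Wx|exact: Gx|].
  apply/eqP => H0; move: Hx; rewrite /H H0 mul0r.
  by rewrite ltNge invr_ge0 ler0n.
exists d, phi; split.
- exact: d0.
- have [b1 _] := phiP a aa; have [ar _] := dsub a aa.
  have := steepN a b (phi a) ar (ballxx b rho0) b1.
  by rewrite phig// gab subrr normr0 mulr0 normr_le0 subr_eq0 => /eqP.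
- exact: implicit_Ck (ball_open a d) cphi CG Gphi.
- by move=> x /Gphi[].
Unshelve. all: by end_near. Qed.

End ImplicitFunction.

(** * Rotations and the exponential of antisymmetric 3 x 3 matrices *)

Section Rotation.
Variable R : realType.
Implicit Types (X Y Z : 'M[R]_3) (A B : 'M[R]_3).

(** The Frobenius inner product. *)
Definition frob A B : R := \tr (A *m B^T).

(** Rodrigues' formula for exp (s X). *)
Definition rodrigues X (s : R) : 'M[R]_3 :=
  1%:M + (sin (s * rnorm X) / rnorm X) *: X
       + ((1 - cos (s * rnorm X)) / rnorm X ^+ 2) *: (X *m X).

Lemma sum3 (V : nmodType) (F : 'I_3 -> V) :
  \sum_i F i = F (inord 0) + F (inord 1) + F (inord 2).
Proof.
rewrite !big_ord_recl big_ord0 addr0 addrA.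
by congr (F _ + F _ + F _); apply/val_inj; rewrite /= inordK.
Qed.

Lemma ord3 (P : 'I_3 -> Prop) :
  P (inord 0) -> P (inord 1) -> P (inord 2) -> forall i, P i.
Proof.
move=> P0 P1 P2 [[|[|[|//]]] lt_i3].
- by rewrite (_ : Ordinal _ = inord 0)//; apply/val_inj; rewrite /= inordK.
- by rewrite (_ : Ordinal _ = inord 1)//; apply/val_inj; rewrite /= inordK.
- by rewrite (_ : Ordinal _ = inord 2)//; apply/val_inj; rewrite /= inordK.
Qed.

Lemma axialE Y : [/\ axial Y (inord 0) 0 = Y (inord 2) (inord 1),
  axial Y (inord 1) 0 = Y (inord 0) (inord 2) &
  axial Y (inord 2) 0 = Y (inord 1) (inord 0)].
Proof. by split; rewrite mxE inordK. Qed.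

Lemma dotvE (v w : 'cV[R]_3) : dotv v w = v (inord 0) 0 * w (inord 0) 0 +
  v (inord 1) 0 * w (inord 1) 0 + v (inord 2) 0 * w (inord 2) 0.
Proof. by rewrite /dotv mxE sum3 !mxE. Qed.

Lemma dotv_axialZl c X Y :
  dotv (axial (c *: X)) (axial Y) = c * dotv (axial X) (axial Y).
Proof.
rewrite !dotvE; have [-> -> ->] := axialE X; have [-> -> ->] := axialE Y.
by have [-> -> ->] := axialE (c *: X); rewrite !mxE; ring.
Qed.

Lemma dotv_axialDl X Z Y : dotv (axial (X + Z)) (axial Y) =
  dotv (axial X) (axial Y) + dotv (axial Z) (axial Y).
Proof.
rewrite !dotvE; have [-> -> ->] := axialE X; have [-> -> ->] := axialE Y.
have [-> -> ->] := axialE Z; have [-> -> ->] := axialE (X + Z).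
by rewrite !mxE; ring.
Qed.

Lemma dotvC (v w : 'cV[R]_3) : dotv v w = dotv w v.
Proof. by rewrite !dotvE; congr (_ + _ + _); exact: mulrC. Qed.

Lemma dotv_ge0 (v : 'cV[R]_3) : 0 <= dotv v v.
Proof. by rewrite dotvE !addr_ge0// -expr2 sqr_ge0. Qed.

Lemma rnorm_sqr X : rnorm X ^+ 2 = dotv (axial X) (axial X).
Proof. by rewrite sqr_sqrtr// dotv_ge0. Qed.

Lemma rnorm_ge0 X : 0 <= rnorm X.
Proof. exact: sqrtr_ge0. Qed.

Lemma rnormZ c X : rnorm (c *: X) = `|c| * rnorm X.
Proof.
rewrite /rnorm /enorm dotv_axialZl dotvC dotv_axialZl mulrA -expr2.
by rewrite sqrtrM ?sqr_ge0// sqrtr_sqr.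
Qed.

Lemma so3P Y : so3 Y -> forall i j, Y i j = - Y j i.
Proof. by move=> sY i j; have /matrixP/(_ j i) := sY; rewrite !mxE. Qed.

Lemma so3_diag Y i : so3 Y -> Y i i = 0.
Proof. by move=> /so3P/(_ i i) e; lra. Qed.

Lemma so3Z c Y : so3 Y -> so3 (c *: Y).
Proof. by move=> sY; rewrite /so3 /= linearZ /= sY scalerN. Qed.

Lemma so3_rnorm0 Y : so3 Y -> rnorm Y = 0 -> Y = 0.
Proof.
move=> sY /eqP; rewrite -sqrf_eq0 rnorm_sqr dotvE -!expr2.
have [-> -> ->] := axialE Y.
rewrite !paddr_eq0 ?addr_ge0 ?sqr_ge0// !sqrf_eq0.
move=> /andP[/andP[/eqP e21 /eqP e02] /eqP e10].
by apply/matrixP; elim/ord3; elim/ord3; rewrite mxE ?so3_diag// ?e21 ?e02 ?e10//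
  (so3P sY) ?e21 ?e02 ?e10 oppr0.
Qed.

Lemma so3_entries Y : so3 Y ->
  [/\ Y (inord 0) (inord 1) = - Y (inord 1) (inord 0),
      Y (inord 2) (inord 0) = - Y (inord 0) (inord 2),
      Y (inord 1) (inord 2) = - Y (inord 2) (inord 1) &
      forall i, Y i i = 0].
Proof. by move=> sY; split; [..|move=> i; exact: so3_diag]; exact: so3P. Qed.

(** The Cayley-Hamilton theorem: the characteristic polynomial of Y is
    t^3 + |Y|^2 t. *)
Lemma so3_cube Y : so3 Y -> Y *m Y *m Y = - rnorm Y ^+ 2 *: Y.
Proof.
move=> sY; rewrite rnorm_sqr dotvE; have [-> -> ->] := axialE Y.
have [e1 e2 e3 e4] := so3_entries sY.
by apply/matrixP; elim/ord3; elim/ord3;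
  rewrite !mxE !sum3 !mxE !sum3 !e4 ?e1 ?e2 ?e3; ring.
Qed.

Lemma frobE A B : frob A B = \sum_i \sum_j A i j * B i j.
Proof.
by apply: eq_bigr => i _; rewrite mxE; apply: eq_bigr => j _; rewrite mxE.
Qed.

Lemma frob1 Z : frob 1%:M Z = \tr Z.
Proof. by rewrite /frob mul1mx mxtrace_tr. Qed.

Lemma frobDl A A' B : frob (A + A') B = frob A B + frob A' B.
Proof. by rewrite /frob mulmxDl mxtraceD. Qed.

Lemma frobZl c A B : frob (c *: A) B = c * frob A B.
Proof. by rewrite /frob -scalemxAl mxtraceZ. Qed.

Lemma so3_trace Z : so3 Z -> \tr Z = 0.
Proof. by move=> sZ; apply: big1 => i _; exact: so3_diag. Qed.

Lemma frob_so3 Y Z : so3 Y -> so3 Z ->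
  frob Y Z = 2 * dotv (axial Y) (axial Z).
Proof.
move=> sY sZ; rewrite frobE dotvE; have [-> -> ->] := axialE Y.
have [-> -> ->] := axialE Z.
have [e1 e2 e3 e4] := so3_entries sY; have [f1 f2 f3 f4] := so3_entries sZ.
by rewrite !sum3 !e4 !f4 e1 e2 e3 f1 f2 f3; ring.
Qed.

Lemma frob_so3_sqr Y Z : so3 Y -> so3 Z -> frob (Y *m Y) Z = 0.
Proof.
move=> sY sZ; rewrite /frob sZ mulmxN raddfN /=.
have tr_eq : \tr (Y *m Y *m Z) = - \tr (Y *m Y *m Z).
  rewrite -[LHS]mxtrace_tr !trmx_mul sZ sY !mulNmx !mulmxN !opprK.
  by rewrite raddfN mxtrace_mulC mulmxA.
by lra.
Qed.

(** The terms 1 and X^2 of Rodrigues' formula are symmetric, hence orthogonal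
    to the antisymmetric matrix Z. *)
Lemma rodrigues_frob X Z s : so3 X -> so3 Z -> frob (rodrigues X s) Z =
  2 * (sin (s * rnorm X) / rnorm X) * dotv (axial X) (axial Z).
Proof.
move=> sX sZ; rewrite /rodrigues !frobDl !frobZl frob1 so3_trace//.
by rewrite frob_so3// frob_so3_sqr// mulr0 addr0 add0r mulrCA mulrA.
Qed.

Lemma rodrigues_trace X s : so3 X -> rnorm X != 0 ->
  \tr (rodrigues X s) = 1 + 2 * cos (s * rnorm X).
Proof.
move=> sX X0; rewrite /rodrigues !mxtraceD !mxtraceZ mxtrace1 so3_trace//.
rewrite mulr0 addr0.
have -> : \tr (X *m X) = - 2 * rnorm X ^+ 2.
  have -> : \tr (X *m X) = - frob X X by rewrite /frob sX mulmxN raddfN opprK.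
  by rewrite frob_so3// rnorm_sqr mulNr.
by field.
Qed.

Lemma rodrigues_mul X s : so3 X -> rnorm X != 0 -> rodrigues X s *m X =
  cos (s * rnorm X) *: X + (sin (s * rnorm X) / rnorm X) *: (X *m X).
Proof.
move=> sX X0; rewrite /rodrigues !mulmxDl mul1mx -!scalemxAl so3_cube//.
rewrite scalerA addrAC -{1}(scale1r X) -scalerDl; congr (_ *: _ + _).
by field.
Qed.

(** Since X^3 = - |X|^2 X, the powers of X alternate between multiples of X and
    of X^2, and the exponential series splits into a sine and a cosine
    series. *)
Lemma so3_expr X (n : nat) : so3 X -> rnorm X != 0 -> (n`!%:R)^-1 *: X ^+ n =
  (n == 0%N)%:R *: 1%:M + (sin_coeff (rnorm X) n / rnorm X) *: X
  + (((n == 0%N)%:R - cos_coeff (rnorm X) n) / rnorm X ^+ 2) *: (X *m X).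
Proof.
move=> sX X0.
have oddE j : X ^+ j.*2.+1 = ((-1) ^+ j * rnorm X ^+ j.*2) *: X.
  elim: j => [|j IH]; first by rewrite expr1 !expr0 mulr1 scale1r.
  rewrite doubleS 2!exprSr IH -!scalerAl -[X * X * X]/(X *m X *m X) so3_cube//.
  rewrite scalerA; congr (_ *: _).
  by rewrite !exprS; ring.
have [m] : exists m, n = m.*2 \/ n = m.*2.+1.
  exists n./2; have := odd_double_half n.
  by case: (odd n) => e; [right|left]; exact: esym e.
move=> [] ->.
  rewrite /sin_coeff /cos_coeff /= odd_double /= !mul0r scale0r addr0 mul1r.
  rewrite doubleK.
  case: m => [|m].
    rewrite double0 !expr0 fact0 invr1 expr0z !mulr1 subrr mul0r scale0r.
    by rewrite addr0.
  rewrite scale0r add0r doubleS exprSr oddE -scalerAl scalerA sub0r.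
  congr (_ *: _).
  rewrite -addn2 [rnorm X ^+ (_ + _)]exprD -exprnP exprS.
  by field; rewrite X0 pnatr_eq0 -lt0n fact_gt0.
rewrite /sin_coeff /cos_coeff /= odd_double /= !mul0r subrr mul0r !scale0r.
rewrite addr0 add0r mul1r oddE scalerA ?uphalf_double ?doubleK.
congr (_ *: _); rewrite exprS.
by field; rewrite X0 pnatr_eq0 -lt0n fact_gt0.
Qed.

Lemma expmx_rodrigues X : so3 X -> rnorm X != 0 -> expmx X = rodrigues X 1.
Proof.
move=> sX X0; rewrite /expmx /rodrigues mul1r; set x := rnorm X.
set u := series _.
pose d (n : nat) : R := (n == 0%N)%:R.
have uE n : u n = series d n *: 1%:M + (series (sin_coeff x) n / x) *: X
    + ((series d n - series (cos_coeff x) n) / x ^+ 2) *: (X *m X).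
  elim: n => [|n IH].
    by rewrite /u !seriesEnat /= !big_geq// subrr !mul0r !scale0r !addr0.
  rewrite /u !seriesSr -/u IH [X in _ + X = _](so3_expr n sX X0) -/x -/(d n).
  by apply/matrixP => i j; rewrite !mxE; ring.
have cd : series d @ \oo --> (1 : R).
  rewrite -(cvg_shiftS (series d)); apply: cvg_near_cst; near=> n.
  by rewrite seriesEnat /= big_nat_recl//= big1 ?addr0.
have cs : series (sin_coeff x) @ \oo --> sin x.
  by rewrite unlock; exact: is_cvg_series_sin_coeff.
have cc : series (cos_coeff x) @ \oo --> cos x.
  by rewrite unlock; exact: is_cvg_series_cos_coeff.
apply: cvg_lim => //; rewrite (funext uE).
apply: cvgD; first apply: cvgD.
- by rewrite -[X in _ --> X]scale1r; apply: cvgZr_tmp.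
- by apply: cvgZr_tmp; apply: cvgM => //; exact: cvg_cst.
- apply: cvgZr_tmp; apply: cvgM; last exact: cvg_cst.
  exact: cvgB.
Unshelve. all: by end_near. Qed.

End Rotation.
Section LinearODE.
Variable R : realType.
Implicit Types (X : 'M[R]_3) (A : R -> 'M[R]_3).

Lemma is_derive_lin (V W : normedModType R) (L : {linear V -> W})
    (f : R -> V) (t : R) df :
  continuous L -> is_derive t 1 f df -> is_derive t 1 (L \o f) (L df).
Proof.
move=> cL [/derivable1_diffP dft <-].
have dL : is_diff (f t) L L.
  by apply: DiffDef; [exact: linear_differentiable|exact: diff_lin].
have := is_diff_is_derive (1 : R) (is_diff_comp (differentiableP dft) dL).
by rewrite (deriveE _ dft).
Qed.

Lemma is_derive_entry m n (f : R -> 'M[R]_(m, n)) (t : R) df i j :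
  is_derive t 1 f df -> is_derive t 1 (fun s => f s i j) (df i j).
Proof.
have lc : linear (fun B : 'M[R]_(m, n) => B i j : R).
  by move=> c B C; rewrite !mxE.
pose lM := GRing.isLinear.Build _ _ _ _ _ lc.
pose L : {linear 'M[R]_(m, n) -> R} := 
  HB.pack (fun B : 'M[R]_(m, n) => B i j : R) lM.
move=> df'; apply: (@is_derive_lin _ _ L) => //; exact: coord_continuous.
Qed.

Lemma is_derive_rodrigues_entry X (t : R) i j :
  so3 X -> rnorm X != 0 ->
  is_derive t 1 (fun s => rodrigues X s i j) ((rodrigues X t *m X) i j).
Proof.
move=> sX X0; rewrite rodrigues_mul//.
have -> : (fun s => rodrigues X s i j) = (fun s =>
    1%:M i j + (X i j / rnorm X) * sin (s * rnorm X)
    + ((X *m X) i j / rnorm X ^+ 2) * (1 - cos (s * rnorm X))).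
  by apply/funext => s; rewrite /rodrigues !mxE; ring.
have ds : is_derive t 1 (fun s => sin (s * rnorm X))
    (cos (t * rnorm X) * rnorm X).
  apply: (@is_derive1_comp R sin (fun s => s * rnorm X)); apply: is_derive_eq.
  by rewrite /GRing.scale /= mulr0 add0r mulr1.
have dc : is_derive t 1 (fun s => cos (s * rnorm X))
    (- sin (t * rnorm X) * rnorm X).
  apply: (@is_derive1_comp R cos (fun s => s * rnorm X)); apply: is_derive_eq.
  by rewrite /GRing.scale /= mulr0 add0r mulr1.
apply: is_derive_eq; rewrite !mxE /GRing.scale /=.
by field.
Qed.

(** Along a solution, A (t) and the one-parameter group of X satisfy the same
    linear equation, so that A (t) exp (t X)^T is constant. *)
Lemma linear_ode_rodrigues A X : so3 X -> rnorm X != 0 ->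
  (forall t : R, is_derive t 1 A (A t *m X)) -> (forall t, SO3 (A t)) ->
  A 0 = 1%:M -> forall t, A t = rodrigues X t.
Proof.
move=> sX X0 dA SA A0 t.
have R0 : rodrigues X 0 = 1%:M.
  by rewrite /rodrigues !mul0r sin0 cos0 subrr !mul0r !scale0r !addr0.
have AR : A t *m (rodrigues X t)^T = 1%:M.
  rewrite -[RHS](mul1mx 1%:M) -{1}A0 -trmx1 -R0; apply/matrixP => i j.
  apply: (@is_derive_0_is_cst R (fun s => (A s *m (rodrigues X s)^T) i j)) => s.
  have -> : (fun s => (A s *m (rodrigues X s)^T) i j) = (fun s =>
      A s i (inord 0) * rodrigues X s j (inord 0) +
      A s i (inord 1) * rodrigues X s j (inord 1) +
      A s i (inord 2) * rodrigues X s j (inord 2)).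
    by apply/funext => r; rewrite mxE sum3 ![_^T _ _]mxE.
  have dAe k := is_derive_entry i k (dA s).
  have dRe k := is_derive_rodrigues_entry s j k sX X0.
  have zero : (A s *m X *m (rodrigues X s)^T
               + A s *m (rodrigues X s *m X)^T) i j = 0.
    by rewrite trmx_mul sX mulNmx mulmxN mulmxA subrr mxE.
  have dD := is_deriveD (is_deriveD (is_deriveM (dAe (inord 0)) (dRe (inord 0)))
    (is_deriveM (dAe (inord 1)) (dRe (inord 1))))
    (is_deriveM (dAe (inord 2)) (dRe (inord 2))).
  move: dD; set df := (X in is_derive _ _ _ X -> _).
  suff -> : df = 0 by apply.
  rewrite /df -zero [in RHS]mxE [in X in _ = X + _]mxE [in X in _ = _ + X]mxE.
  rewrite !sum3.
  rewrite ![(_ ^T) _ _]mxE /GRing.scale /=.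
  by ring.
have [AA _] := SA t.
have ATA : (A t)^T *m A t = 1%:M by exact: mulmx1C.
apply: trmx_inj.
by rewrite -[LHS]mulmx1 -AR mulmxA ATA mul1mx.
Qed.

End LinearODE.

(** * The return rotation after one period and its transversality *)

Section ReturnRotation.
Variable R : realType.

Lemma open_preimage_in (E F : normedModType R) (U : set E) (V : set F)
    (f : E -> F) : open U -> (forall x, U x -> {for x, continuous f}) ->
  open V -> open (U `&` f @^-1` V).
Proof.
move=> oU cf oV; apply: (continuous_inP f oU).1 => // x; rewrite inE; exact: cf.
Qed.

Lemma frob_continuous (Z : 'M[R]_3) : continuous (fun B => frob B Z).
Proof.
move=> B.
have cB i j : (fun B : 'M[R]_3 => B i j * Z i j) @ B --> B i j * Z i j.
  have cc : (fun B : 'M[R]_3 => B i j) @ B --> B i j by exact: coord_continuous.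
  exact: cvgM cc (cvg_cst _).
have cr i : (fun B : 'M[R]_3 => \sum_j B i j * Z i j) @ B
    --> \sum_j B i j * Z i j.
  rewrite sum3 (_ : (fun _ => _) = (fun B : 'M[R]_3 =>
    B i (inord 0) * Z i (inord 0) + B i (inord 1) * Z i (inord 1)
    + B i (inord 2) * Z i (inord 2))).
    exact: cvgD (cvgD (cB _ _) (cB _ _)) (cB _ _).
  by apply/funext => C; exact: sum3.
have -> : (fun B => frob B Z) = (fun B => \sum_j B (inord 0) j * Z (inord 0) j
    + \sum_j B (inord 1) j * Z (inord 1) j
    + \sum_j B (inord 2) j * Z (inord 2) j).
  by apply/funext => C; rewrite frobE; exact: sum3.
exact: cvgD (cvgD (cr _) (cr _)) (cr _).
Qed.

Lemma Ck_frob k (E : normedModType R) (U : set E) (B : E -> 'M[R]_3) Z :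
  open U -> Ck k U B -> Ck k U (fun x => frob (B x) Z).
Proof.
move=> oU CB.
have lf : linear (fun B : 'M[R]_3 => frob B Z).
  by move=> c C D; rewrite frobDl frobZl.
pose fM := GRing.isLinear.Build _ _ _ _ _ lf.
pose L : {linear 'M[R]_3 -> R} := HB.pack (fun B : 'M[R]_3 => frob B Z) fM.
apply: (@Ck_comp R k _ _ _ U setT B L) => //.
by apply: Ck_lin; exact: frob_continuous.
Qed.

(** In the variable eps with lambda = eps^2, the rotation after one period is
    the restriction to eps >= 0 of a smooth map of (eps, mu) on a neighbourhood
    of the origin, although the data are given for lambda >= 0 only.
    Near the Hopf point the frequency keeps the sign of omega_bif, so that the
    absolute value in the period 2 pi / |omega| does not spoil smoothness. *)
Lemma return_rotation_extension k (del omega_bif : R) (omega s : R -> R -> R)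
    (h : R -> R) (C : R) (A : R -> R -> R -> 'M[R]_3) :
  0 < del -> omega_bif <> 0 ->
  Ck k [set mu : R | `|mu| < del] h ->
  (forall mu, `|mu| < del -> `|h mu| <= C * `|mu|) ->
  CS k [set mu : R | `|mu| < del] del (fun mu lam => s lam mu) ->
  (forall lam mu, 0 <= lam < del -> `|mu| < del ->
     omega lam mu = omega_bif + h mu + lam * s lam mu) ->
  CS k [set p : R * R | `|p.2| < del] del (fun p lam => A p.1 lam p.2) ->
  exists (W : set (R * R)) (B : R * R -> 'M[R]_3),
    [/\ open W, W (0, 0), Ck k W B &
        forall e mu, W (e, mu) -> `|mu| < del /\ (0 <= e < Num.sqrt del ->
          B (e, mu) = A (period omega (e ^+ 2) mu) (e ^+ 2) mu)].
Proof.
move=> del0 ob0 Ch hC Cs omegaE CA.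
have sd0 : 0 < Num.sqrt del by rewrite sqrtr_gt0.
have h0 : h 0 = 0.
  by have := hC 0; rewrite normr0 mulr0 => /(_ del0); rewrite normr_le0 => /eqP.
have [|Us [gs [oUs Us0 Cgs gsE]]] := Cs (0, 0).
  by rewrite /= normr0 lexx.
pose om (p : R * R) := omega_bif + h p.2 + p.1 * p.1 * gs (p.2, p.1).
pose swap (p : R * R) := (p.2, p.1).
have oD : open [set mu : R | `|mu| < del].
  rewrite (_ : [set _ | _] = ball 0 del); first exact: ball_open.
  by apply/seteqP; split=> mu; rewrite /ball/= /ball_ /= sub0r normrN.
pose W1 : set (R * R) := [set p | `|p.2| < del] `&` [set p | Us (p.2, p.1)].
have oT : open [set: R * R] by exact: openT.
have Cswap : Ck k [set: R * R] swap.
  by apply: Ck_pair => //; [exact: Ck_snd|exact: Ck_fst].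
have oW1 : open W1.
  apply: openI.
    rewrite (_ : [set p | _] =
      [set: R * R] `&` snd @^-1` [set mu : R | `|mu| < del]); last first.
      by rewrite setTI.
    apply: (open_preimage_in oT _ oD) => p _.
    exact: (Ck_continuous (@Ck_snd R 0 _ _ setT)).
  rewrite (_ : [set p | _] = [set: R * R] `&` swap @^-1` Us); last first.
    by rewrite setTI.
  apply: (open_preimage_in oT _ oUs) => p _; exact: (Ck_continuous Cswap).
have Com : Ck k W1 om.
  have C1 : Ck k W1 (fun=> omega_bif) by exact: Ck_cst.
  have Cf : Ck k W1 fst by exact: Ck_fst.
  have C2 : Ck k W1 (h \o snd).
    by apply: (@Ck_comp R k _ _ _ _ [set mu : R | `|mu| < del]) => //;
      [move=> p []|exact: Ck_snd].
  have C3 : Ck k W1 (gs \o swap).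
    apply: (@Ck_comp R k _ _ _ _ Us) => //; first by move=> p [].
    exact: Ck_sub Cswap.
  exact: Ck_add (Ck_add _ C1 C2) (Ck_mul _ (Ck_mul _ Cf Cf) C3).
pose W2 := W1 `&` om @^-1` [set z | 0 < Num.sg omega_bif * z].
have oW2 : open W2.
  apply: (open_preimage_in oW1); first by move=> p; exact: Ck_continuous Com.
  rewrite (_ : [set z | _] = [set: R] `&`
    (fun z => Num.sg omega_bif * z) @^-1` [set z | z > 0]); last first.
    by rewrite setTI.
  apply: (open_preimage_in openT); last exact: open_gt.
  by move=> z _; apply: cvgM; [exact: cvg_cst|exact: cvg_id].
pose T p := 2 * pi * (Num.sg omega_bif * om p)^-1.
have CT : Ck k W2 T.
  have Com2 : Ck k W2 om by apply: Ck_sub Com; exact: subIsetl.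
  have C1 : Ck k W2 (fun=> 2 * pi : R) by exact: Ck_cst.
  have C2 : Ck k W2 (fun=> Num.sg omega_bif : R) by exact: Ck_cst.
  apply: Ck_mul => //; apply: Ck_inv => //.
    by move=> p [_ /=]; exact: lt0r_neq0.
  exact: Ck_mul.
pose w p := ((T p, p.2), p.1).
have Cw : Ck k W2 w.
  apply: Ck_pair => //; last exact: Ck_fst.
  by apply: Ck_pair => //; exact: Ck_snd.
have om0 : om (0, 0) = omega_bif by rewrite /om h0 addr0 !mul0r addr0.
have W20 : W2 (0, 0).
  split; first by split; rewrite //= normr0.
  rewrite /= om0 -normrEsg.
  by rewrite normr_gt0; apply/eqP.
have [|Ua [ga [oUa Ua0 Cga gaE]]] := CA (w (0, 0)).
  by rewrite /= normr0 lexx.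
exists (W2 `&` w @^-1` Ua), (ga \o w); split.
- by apply: (open_preimage_in oW2 _ oUa) => p; exact: Ck_continuous Cw.
- by split.
- apply: (@Ck_comp R k _ _ _ _ Ua) => //.
  + by apply: (open_preimage_in oW2 _ oUa) => p; exact: Ck_continuous Cw.
  + by move=> p [].
  + by apply: Ck_sub Cw; exact: subIsetl.
- move=> e mu [[[/= mud Use] /= sgo] Uaw]; split=> // /andP[e0 ed].
  have e2 : e ^+ 2 < del.
    by rewrite -(sqr_sqrtr (ltW del0)) ltr_sqr ?nnegrE// ltW.
  have omE : om (e, mu) = omega (e ^+ 2) mu.
    rewrite omegaE ?sqr_ge0//= /om /= -expr2 gsE//=; last by rewrite mud e0.
  rewrite /= gaE//= ?mud ?e0//; congr (A _ _ _).
  rewrite /T /period -omE -(gtr0_norm sgo) normrM normr_sg.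
  by move/eqP: ob0 => ->; rewrite mul1r.
Qed.

End ReturnRotation.

Section Transversality.
Variable R : realType.

Lemma sin_cos_2pin (n : nat) :
  sin (2 * pi * n%:R : R) = 0 /\ cos (2 * pi * n%:R : R) = 1.
Proof.
have -> : 2 * pi * n%:R = 0 + pi *+ 2 *+ n :> R.
  by rewrite add0r -[in RHS]mulr_natr -(mulr_natl pi 2).
rewrite (periodicn (@sinD2pi R)) (periodicn (@cosD2pi R)).
by rewrite sin0 cos0.
Qed.

Lemma is_derive_dotv_axial (Y : R -> 'M[R]_3) (dY Z : 'M[R]_3) (t : R) :
  is_derive t 1 Y dY -> is_derive t 1 (fun s => dotv (axial (Y s)) (axial Z))
    (dotv (axial dY) (axial Z)).
Proof.
move=> dYt; have dYe i j := is_derive_entry i j dYt.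
have dE (M : 'M[R]_3) : dotv (axial M) (axial Z) =
    Z (inord 2) (inord 1) * M (inord 2) (inord 1) +
    Z (inord 0) (inord 2) * M (inord 0) (inord 2) +
    Z (inord 1) (inord 0) * M (inord 1) (inord 0).
  rewrite dotvE; have [-> -> ->] := axialE M; have [-> -> ->] := axialE Z.
  by ring.
rewrite (funext (fun s => dE (Y s))) dE.
exact: is_deriveD (is_deriveD (is_deriveZ _ (dYe _ _)) (is_deriveZ _ (dYe _ _)))
  (is_deriveZ _ (dYe _ _)).
Qed.

Lemma is_derive_rnorm (Y : R -> 'M[R]_3) (dY : 'M[R]_3) (t : R) :
  is_derive t 1 Y dY -> rnorm (Y t) != 0 ->
  is_derive t 1 (fun s => rnorm (Y s))
    (dotv (axial dY) (axial (Y t)) / rnorm (Y t)).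
Proof.
move=> dYt Y0; have dYe i j := is_derive_entry i j dYt.
have N0 : 0 < dotv (axial (Y t)) (axial (Y t)).
  by rewrite -rnorm_sqr lt_neqAle sqr_ge0 eq_sym sqrf_eq0 Y0.
pose sq (i j : 'I_3) (s : R) := Y s i j * Y s i j.
have dsq i j : is_derive t 1 (sq i j) (2 * (dY i j * Y t i j)).
  have := is_deriveM (dYe i j) (dYe i j).
  by congr (is_derive _ _ _ _); rewrite /GRing.scale /=; ring.
have dN : is_derive t 1 (fun s => dotv (axial (Y s)) (axial (Y s)))
    (2 * dotv (axial dY) (axial (Y t))).
  have -> : (fun s => dotv (axial (Y s)) (axial (Y s))) =
      sq (inord 2) (inord 1) + sq (inord 0) (inord 2) + sq (inord 1) (inord 0).
    by apply/funext => s; rewrite dotvE; have [-> -> ->] := axialE (Y s).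
  rewrite dotvE; have [-> -> ->] := axialE dY; have [-> -> ->] := axialE (Y t).
  have := is_deriveD (is_deriveD (dsq (inord 2) (inord 1))
    (dsq (inord 0) (inord 2))) (dsq (inord 1) (inord 0)).
  by congr (is_derive _ _ _ _); ring.
have dS := is_derive1_sqrt N0.
have := @is_derive1_comp R Num.sqrt _ t _ _ dS dN.
congr (is_derive _ _ _ _).
by rewrite -/(enorm (axial (Y t))) -/(rnorm (Y t)); field.
Qed.

Lemma is_derive_period (om : R -> R) (dom t : R) :
  is_derive t 1 om dom -> om t != 0 ->
  is_derive t 1 (fun s => 2 * pi / `|om s|)
    (- (2 * pi / `|om t|) * (dom / om t)).
Proof.
move=> domt om0; set sg := Num.sg (om t).
have sg0 : sg != 0 by rewrite sgr_eq0.
have c_om : {for t, continuous om}.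
  by apply/differentiable_continuous/derivable1_diffP; exact: ex_derive.
have dV : is_derive t 1 (fun s => (sg * om s)^-1)
    (- (sg * om t) ^- 2 *: (sg *: dom)).
  have dso : is_derive t 1 (fun s => sg * om s) (sg *: dom).
    exact: (is_deriveZ sg domt).
  by apply: is_deriveV dso; rewrite mulf_neq0.
have pos : 0 < sg * om t by rewrite -normrEsg normr_gt0.
have dT := is_deriveZ (2 * pi) dV.
have nE : \forall s \near t, 2 * pi * (sg * om s)^-1 = 2 * pi / `|om s|.
  have cs : (fun s => sg * om s) @ t --> sg * om t.
    exact: cvgM (cvg_cst _) c_om.
  near=> s.
  have ps : 0 < sg * om s by near: s; exact: (cvgr_gt _ cs).
  by rewrite -(gtr0_norm ps) normrM normr_sg om0 mul1r.
have := near_eq_is_derive nE dT.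
congr (is_derive _ _ _ _).
rewrite normrEsg -/sg /GRing.scale /=.
by field; rewrite om0 sg0.
Unshelve. all: by end_near. Qed.

(** At s = 0 the rotation is trivial, so only the variation of the angle
    T |Y| contributes to the component along X0 of the rotation. *)
Lemma return_rotation_derive (Y : R -> 'M[R]_3) (dY X0 : 'M[R]_3) (om : R -> R)
    (dom : R) (k : int) :
  so3 X0 -> rnorm X0 != 0 -> (forall s, so3 (Y s)) -> Y 0 = X0 ->
  is_derive (0 : R) 1 Y dY -> is_derive (0 : R) 1 om dom -> om 0 != 0 ->
  rnorm X0 = k%:~R * om 0 ->
  [/\ rodrigues X0 (2 * pi / `|om 0|) = 1%:M &
  is_derive (0 : R) 1 (fun s => frob (rodrigues (Y s) (2 * pi / `|om s|)) X0)
    (2 * rnorm X0 * (2 * pi / `|om 0|) *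
     (dotv (axial dY) (axial X0) / rnorm X0 - k%:~R * dom))].
Proof.
move=> sX nX0 sY Y0 dY0 dom0 om0 kE.
pose x s := rnorm (Y s); pose T s := 2 * pi / `|om s|.
have x0 : x 0 = rnorm X0 by rewrite /x Y0.
have [n Tx] : exists n : nat, T 0 * rnorm X0 = 2 * pi * n%:R.
  exists `|k|%N; rewrite /T.
  rewrite -[rnorm X0]ger0_norm ?rnorm_ge0// kE normrM natr_absz intr_norm.
  by field; rewrite normr_eq0.
have [s0 c1] := sin_cos_2pin n.
split.
  by rewrite /rodrigues -/(T 0) Tx s0 c1 subrr !mul0r !scale0r !addr0.
have xn0 : rnorm (Y 0) != 0 by rewrite Y0.
have dx := is_derive_rnorm dY0 xn0.
have dT := is_derive_period dom0 om0.
have dTx := is_deriveM dT dx.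
have dS : is_derive (0 : R) 1 (fun s => sin (T s * x s))
    (cos (T 0 * x 0) * (T 0 * (dotv (axial dY) (axial (Y 0)) / x 0)
                        + x 0 * (- T 0 * (dom / om 0)))).
  exact: @is_derive1_comp R sin _ 0 _ _ (is_derive_sin _) dTx.
have dxV : is_derive (0 : R) 1 (fun s => (x s)^-1)
    (- (x 0) ^- 2 *: (dotv (axial dY) (axial (Y 0)) / rnorm (Y 0))).
  by apply: is_deriveV dx.
have dD := is_derive_dotv_axial X0 dY0.
have dq : is_derive (0 : R) 1 (fun s => sin (T s * x s) / x s) _ :=
  is_deriveM dS dxV.
have := is_deriveM (is_deriveZ 2 dq) dD.
have -> : (fun s => frob (rodrigues (Y s) (2 * pi / `|om s|)) X0) =
  (fun s => 2 * (sin (T s * x s) / x s) * dotv (axial (Y s)) (axial X0)).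
  by apply/funext => s; rewrite rodrigues_frob.
congr (is_derive _ _ _ _).
rewrite /GRing.scale /= -/(T 0) -/(x 0) x0 Tx s0 c1 Y0 -rnorm_sqr.
rewrite !(mul0r, mulr0, addr0, mul1r).
have -> : k%:~R = rnorm X0 / om 0 by rewrite kE mulfK.
by field; rewrite om0 nX0.
Qed.

End Transversality.

(** * The curve of orthogonal frequency vectors *)

Section OrthogonalCurve.
Variable R : realType.
Implicit Types X W : 'M[R]_3.

(** Outside the hemisphere of X0 the vector Y is replaced by its opposite
    representative, of norm 2 pi - |Y|; the value 2 pi itself is not reached
    because Y = 0 is left in place. *)
Lemma qD_rnorm X0 W : qD X0 W -> so3 W /\ rnorm W < 2 * pi.
Proof.
have pi0 := pi_gt0 R.
move=> [Y [sY Ypi ->]]; rewrite /qmap; case: asboolP => [_|nY].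
  by split=> //; lra.
split; first exact: so3Z.
have Y0 : 0 < rnorm Y.
  rewrite lt_neqAle rnorm_ge0 andbT eq_sym; apply/eqP => /(so3_rnorm0 sY) Y0.
  by apply: nY; left.
rewrite rnormZ -{2}(gtr0_norm Y0) -normrM mulrBl divfK ?lt0r_neq0// mul1r.
by rewrite ltr_norml; apply/andP; split; lra.
Qed.

(** Away from the rotations by the angle pi, where the trace is -1, the
    antisymmetric part of exp W is a nonzero multiple of W. *)
Lemma expmx_frob_orthogonal X0 W : so3 X0 -> so3 W -> rnorm W < 2 * pi ->
  -1 < \tr (expmx W) -> frob (expmx W) X0 = 0 ->
  dotv (axial W) (axial X0) = 0.
Proof.
move=> sX sW W2 trW; have [W0|W0] := eqVneq (rnorm W) 0.
  by rewrite (so3_rnorm0 sW W0) -(scale0r W) dotv_axialZl mul0r.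
rewrite expmx_rodrigues// in trW *.
rewrite rodrigues_frob// => /eqP; rewrite !mulf_eq0 invr_eq0 (negbTE W0) orbF.
rewrite mul1r pnatr_eq0 /= => /orP[|/eqP//] s0; exfalso.
move: trW; rewrite rodrigues_trace// mul1r => trW.
have wpos : 0 < rnorm W by rewrite lt_neqAle eq_sym W0 rnorm_ge0.
have [wpi|piw|wpi] := ltgtP (rnorm W) pi.
- have := @sin_gt0_pi R (rnorm W); rewrite wpos wpi => /(_ isT).
  by rewrite (eqP s0) ltxx.
- have := @sin_gt0_pi R (rnorm W - pi).
  have -> : 0 < rnorm W - pi < pi by apply/andP; split; lra.
  move=> /(_ isT); have := sinDpi (rnorm W - pi); rewrite subrK (eqP s0).
  by move=> /esym/eqP; rewrite oppr_eq0 => /eqP ->; rewrite ltxx.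
- by move: trW; rewrite wpi cospi; lra.
Qed.

(** The implicit function theorem for (e, mu) |-> <B (e, mu), X0>, on the
    neighbourhood of (0, 0) where the trace, equal to 3 at the identity, stays
    above the value -1 of the rotations by pi. *)
Lemma transversal_curve k (W : set (R * R)) (B : R * R -> 'M[R]_3) X0 (D : R) :
  open W -> W (0, 0) -> Ck k.+1 W B -> so3 X0 -> B (0, 0) = 1%:M ->
  is_derive (0 : R) 1 (fun mu => frob (B (0, mu)) X0) D -> D != 0 ->
  exists (d : R) (phi : R -> R),
    [/\ 0 < d, phi 0 = 0, Ck k.+1 (ball (0 : R) d) phi &
        forall e, ball 0 d e -> [/\ W (e, phi e), -1 < \tr (B (e, phi e)) &
                                    frob (B (e, phi e)) X0 = 0]].
Proof.
move=> oW W0 CB sX B0 dG D0.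
pose G p := frob (B p) X0; pose t p := frob (B p) 1%:M.
have CG : Ck k.+1 W G by exact: Ck_frob.
have Ct : Ck k.+1 W t by exact: Ck_frob.
have tE p : t p = \tr (B p) by rewrite /t /frob trmx1 mulmx1.
pose W' := W `&` t @^-1` [set z | -1 < z].
have oW' : open W'.
  apply: (open_preimage_in oW); last exact: open_gt.
  by move=> p; exact: Ck_continuous Ct.
have CG' : Ck k.+1 W' G by apply: Ck_sub CG; exact: subIsetl.
have W'0 : W' (0, 0).
  split=> //=; rewrite tE B0 mxtrace1.
  by apply: lt_trans (ltrN10 _) _; rewrite ltr0n.
have G0 : G (0, 0) = 0 by rewrite /G B0 frob1 so3_trace.
have dGE : 'd G (0, 0) (0, 1) = D.
  have dd : is_derive (0 : R) 1 (fun mu => G (0, mu)) ('d G (0, 0) (0, 1)).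
    by apply: is_derive_slice; exact: Ck_differentiable CG W0.
  by rewrite -(@derive_val _ _ _ _ _ _ _ dd) (@derive_val _ _ _ _ _ _ _ dG).
have [|d [phi [d0 phi0 Cphi phiP]]] := implicit_function oW' W'0 CG' G0.
  by rewrite dGE.
exists d, phi; split=> // e /phiP[[We te] Ge]; split=> //.
by rewrite -tE.
Qed.

End OrthogonalCurve.

Theorem theorem7p1 (R : realType) (m : nat) (m_ge1 : (1 <= m)%N) :
  exists M : nat,
  forall (N : nat) (S : rd_system R N) (E : phase_space S)
    (Dom : R -> E -> R -> R -> Prop) (Phi : R -> E -> R -> R -> E)
    (u0 : E) (X0 : 'M[R]_3) (P : sfield R N -> sfield R N)
    (Psi : E -> R -> R -> E) (XG : E -> R -> R -> 'M[R]_3)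
    (XN : E -> R -> R -> E)
    (omega_bif : R) (omega : R -> R -> R) (q r : R -> R -> R -> E)
    (A : R -> R -> R -> 'M[R]_3) (X : R -> R -> 'M[R]_3)
    (X01 X1 X2 : 'M[R]_3) (x0 x1 x2 : E -> R -> R -> R)
    (eta del : R) (k : int),
  let V := Vstar u0 P in
  let u := branch_point Psi q in
  let T := period omega in
  0 < eta -> 0 < del ->
  smooth_system S M ->
  local_semiflow Dom Phi M ->
  relative_equilibrium_u0 Dom Phi u0 X0 ->
  spectral_hypothesis u0 X0 P ->
  center_manifold Dom Phi u0 X0 V Psi XG XN M eta del ->
  hopf_bifurcation V XN omega_bif omega q r M eta del ->
  bifurcating_branch Dom Phi X0 Psi XG omega q A X M del ->
  adapted_basis X0 X01 X1 X2 ->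
  (forall v lam mu, V v ->
     XG v lam mu =
       x0 v lam mu *: X01 + x1 v lam mu *: X1 + x2 v lam mu *: X2) ->
  k != 0 ->
  rnorm X0 = k%:~R * omega_bif ->
  derive1 (fun mu : R => x0 0 0 mu) 0 <>
    k%:~R * derive1 (fun mu : R => omega 0 mu) 0 ->
  exists (del1 : R) (muc : R -> R),
    [/\ 0 < del1 <= del,
        muc 0 = 0 /\ (forall lam, 0 <= lam < del1 -> `|muc lam| < del),
        CS_curve m del1 muc,
        CS m [set t : R | 0 <= t] del1
          (fun t lam => Phi t (u lam (muc lam)) lam (muc lam)) &
        forall lam, 0 < lam < del1 ->
          let mu := muc lam in
          [/\ orbitally_stable Dom Phi (u lam mu) lam mu,
              primary_frequency_vector Dom Phi (u lam mu) lam mu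
                (T lam mu) (X lam mu),
              X lam mu <> 0 ->
                modulated_rotating_wave Dom Phi (u lam mu) lam mu
                  (T lam mu) (X lam mu) &
              dotv (axial (X lam mu)) (axial X0) = 0]].
Proof.
case: m m_ge1 => // k0 _; exists k0.+1.
move=> N S E Dom Phi u0 X0 P Psi XG XN omega_bif omega q r A X X01 X1 X2.
move=> x0 x1 x2 eta del k V u T eta0 del0 _ _ re0 _ cm hb bb basis xE k_neq0.
move=> kE trans.
have sX0 := re_so3 re0.
have nX0 : rnorm X0 != 0.
  by apply/eqP => /(so3_rnorm0 sX0); exact: re_neq0 re0.
have del00 : 0 <= (0 : R) < del by rewrite lexx.
have abs0 : `|(0 : R)| < del by rewrite normr0.
(* q = sqrt lambda r vanishes at lambda = 0, so that the equation for A has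
   constant coefficients there. *)
have q0 t mu : `|mu| < del -> q t 0 mu = 0 /\ V 0.
  move=> mud; have [Vq _ qE] := hb_orbit hb t del00 mud.
  by move: qE Vq; rewrite sqrtr0 scale0r => ->.
have V0 : V 0 by have [] := q0 0 0 abs0.
pose Y mu := XG 0 0 mu.
have sY mu : so3 (Y mu) by apply: (cm_XG_so3 cm 0 mu V0).
have Y0 : Y 0 = X0 by exact: cm_XG0 cm.
have [dY dYE] : exists dY, is_derive (0 : R) 1 Y dY.
  have [U [g [oU U0 Cg gE]]] := cm_XG_smooth cm (x := (0, 0, 0)) V0.
  exists ('d g (0, 0, 0) (0, 1)).
  have dg := Ck_differentiable Cg U0.
  have nU : \forall p \near (0 : E, 0 : R, 0 : R), U p by exact: open_nbhs_nbhs.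
  have cs : (fun mu : R => (0 : E, 0 : R, mu)) @ (0 : R)
      --> (0 : E, 0 : R, 0 : R).
    by apply: cvg_pair_nbhs; [exact: cvg_cst|exact: cvg_id].
  have nU0 : \forall mu \near (0 : R), U (0, 0, mu) by exact: cs _ nU.
  have nE : \forall mu \near (0 : R), g (0, 0, mu) = Y mu.
    by apply: filterS nU0 => mu Umu; rewrite gE.
  exact: near_eq_is_derive nE (is_derive_slice dg).
have [[X01E _] [orth1 [orth2 _]] [n01 _] _] := basis.
have x0E mu : x0 0 0 mu = (rnorm X0)^-1 * dotv (axial (Y mu)) (axial X0).
  rewrite dotvC -dotv_axialZl -X01E dotvC /Y (xE 0 0 mu V0).
  rewrite !dotv_axialDl !dotv_axialZl (dotvC (axial X1)) (dotvC (axial X2)).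
  rewrite orth1 orth2 -rnorm_sqr n01.
  by rewrite expr1n !mulr0 !addr0 mulr1.
have dx0 : derive1 (fun mu : R => x0 0 0 mu) 0
    = dotv (axial dY) (axial X0) / rnorm X0.
  have := is_deriveZ (rnorm X0)^-1 (is_derive_dotv_axial X0 dYE).
  rewrite derive1E (funext x0E) => dd; rewrite (@derive_val _ _ _ _ _ _ _ dd).
  exact: mulrC.
have [h [s [Ch [C hC] Cs omP]]] := hb_omega hb.
have h0 : h 0 = 0.
  by have := hC 0 abs0; rewrite normr0 mulr0 normr_le0 => /eqP.
have om00 : omega 0 0 = omega_bif.
  by have [_ ->] := omP 0 0 del00 abs0; rewrite h0 mul0r !addr0.
have obn0 : omega 0 0 != 0 by rewrite om00; apply/eqP; exact: hb_omega_bif hb.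
have near_del : \forall mu \near (0 : R), `|mu| < del.
  by apply/nbhs_ballP; exists del => // mu; rewrite /ball/= /ball_ sub0r normrN.
have dom0 : is_derive (0 : R) 1 (fun mu => omega 0 mu)
    (derive1 (fun mu => omega 0 mu) 0).
  have dh : derivable h 0 1.
    by apply/derivable1_diffP; exact: Ck_differentiable Ch abs0.
  have dc := is_derive_cst omega_bif (0 : R) 1.
  have dd := is_deriveD dc (derivableP dh).
  have nE : \forall mu \near (0 : R), (cst omega_bif + h) mu = omega 0 mu.
    apply: filterS near_del => mu mud.
    by have [_ ->] := omP 0 mu del00 mud; rewrite mul0r addr0.
  have dom := near_eq_is_derive nE dd.
  by rewrite derive1E (@derive_val _ _ _ _ _ _ _ dom).
have kE' : rnorm X0 = k%:~R * omega 0 0 by rewrite om00.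
have [rod1 dfrob] := return_rotation_derive sX0 nX0 sY Y0 dYE dom0 obn0 kE'.
have [W [B [oW W0 CB BE]]] := return_rotation_extension del0 (hb_omega_bif hb)
  Ch hC Cs (fun lam mu l m => (omP lam mu l m).2) (bb_CS_A bb).
have B0E : \forall mu \near (0 : R),
    B (0, mu) = rodrigues (Y mu) (2 * pi / `|omega 0 mu|).
  have nW : \forall mu \near (0 : R), W (0, mu).
    have nW : \forall p \near (0 : R, 0 : R), W p by exact: open_nbhs_nbhs.
    have cs : (fun mu : R => (0 : R, mu)) @ (0 : R) --> (0 : R, 0 : R).
      by apply: cvg_pair_nbhs; [exact: cvg_cst|exact: cvg_id].
    exact: cs _ nW.
  have nY : \forall mu \near (0 : R), 0 < rnorm (Y mu).
    have nY0 : rnorm (Y 0) != 0 by rewrite Y0.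
    have dn := is_derive_rnorm dYE nY0.
    have cn : {for (0 : R), continuous (fun mu => rnorm (Y mu))}.
      by apply/differentiable_continuous/derivable1_diffP; exact: ex_derive.
    by apply: (cvgr_gt _ cn); rewrite lt_neqAle eq_sym nY0 rnorm_ge0.
  near=> mu.
  have Wmu : W (0, mu) by near: mu.
  have Yn0 : rnorm (Y mu) != 0 by rewrite lt0r_neq0//; near: mu.
  have [mud ->] := BE _ _ Wmu; last by rewrite lexx sqrtr_gt0.
  rewrite expr0n /=.
  apply: (@linear_ode_rodrigues R (fun t => A t 0 mu) (Y mu)) => //.
  - by move=> t; have := bb_ode bb t del00 mud; have [-> _] := q0 t mu mud.
  - by move=> t; apply: (bb_SO3 bb t del00 mud).
  - exact: (bb_A0 bb del00 mud).
have B00 : B (0, 0) = 1%:M by rewrite (nbhs_singleton B0E) Y0.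
have nE : \forall mu \near (0 : R),
    frob (rodrigues (Y mu) (2 * pi / `|omega 0 mu|)) X0 = frob (B (0, mu)) X0.
  by apply: filterS B0E => mu ->.
have dG := near_eq_is_derive nE dfrob.
have D0 : 2 * rnorm X0 * (2 * pi / `|omega 0 0|) *
    (dotv (axial dY) (axial X0) / rnorm X0
     - k%:~R * derive1 (fun mu => omega 0 mu) 0) != 0.
  have p0 : pi != 0 :> R by rewrite lt0r_neq0// pi_gt0.
  rewrite !mulf_neq0 ?invr_eq0 ?normr_eq0 ?pnatr_eq0// subr_eq0 -dx0.
  exact/eqP.
have [d [phi [d0 phi0 Cphi phiP]]] := transversal_curve oW W0 CB sX0 B00 dG D0.
pose del1 := Num.min (d ^+ 2) del.
have del10 : 0 < del1 by rewrite lt_min exprn_gt0.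
pose muc lam := phi (Num.sqrt lam).
have muc_sqr e : 0 <= e -> muc (e ^+ 2) = phi e.
  by move=> e0; rewrite /muc sqrtr_sqr ger0_norm.
have ball_d e : 0 <= e < Num.sqrt del1 -> ball 0 d e.
  move=> /andP[e0 ed]; rewrite /ball/= /ball_ sub0r normrN ger0_norm//.
  apply: lt_le_trans ed _; rewrite -[leRHS](gtr0_norm d0) -sqrtr_sqr.
  by apply: ler_wsqrtr; rewrite ge_min lexx.
have sqrt_lam lam : 0 <= lam < del1 -> 0 <= Num.sqrt lam < Num.sqrt del1.
  by move=> /andP[l0 ld]; rewrite sqrtr_ge0 ltr_sqrt.
have lt_del lam : 0 <= lam < del1 -> 0 <= lam < del.
  by move=> /andP[-> ld]; apply: lt_le_trans ld _; rewrite ge_min lexx orbT.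
have muc_del lam : 0 <= lam < del1 -> `|muc lam| < del.
  by move=> /sqrt_lam/ball_d/phiP[/BE[]].
exists del1, muc; split.
- by rewrite del10 ge_min lexx orbT.
- by split; rewrite /muc ?sqrtr0.
- move=> e De; exists (ball 0 d), phi; split.
  + exact: ball_open.
  + exact: ball_d.
  + exact: Cphi.
  + by move=> y _ /andP[y0 _]; rewrite muc_sqr.
- move=> [t e] /= [t0 De].
  have [/andP[e0 ed] bde] := (De, ball_d e De).
  have sqdel y : y < Num.sqrt del1 -> y < Num.sqrt del.
    move=> yd; apply: lt_le_trans yd _.
    by rewrite ler_wsqrtr// ge_min lexx orbT.
  have Wd y : ball 0 d y -> `|phi y| < del by move=> /phiP[/BE[]].
  have [|U [g [oU Uw Cg gE]]] := bb_CS_Phi bb (x := ((t, phi e), e)).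
    by rewrite /= t0 e0 Wd// sqdel.
  pose w (p : R * R) := ((p.1, phi p.2), p.2).
  pose U0 : set (R * R) := [set: R * R] `&` snd @^-1` ball 0 d.
  have oU0 : open U0.
    apply: (open_preimage_in openT _ (ball_open 0 d)) => p _.
    exact: (Ck_continuous (@Ck_snd R 0 _ _ setT)).
  have Cw : Ck k0.+1 U0 w.
    apply: (Ck_pair oU0); last exact: Ck_snd.
    apply: (Ck_pair oU0); first exact: Ck_fst.
    by apply: (Ck_comp oU0 _ _ Cphi); [move=> p []|exact: Ck_snd].
  have oU1 : open (U0 `&` w @^-1` U).
    by apply: (open_preimage_in oU0 _ oU) => p; exact: Ck_continuous Cw.
  exists (U0 `&` w @^-1` U), (g \o w); split.
  + exact: oU1.
  + by [].
  + apply: (Ck_comp oU1 _ _ Cg); first by move=> p [].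
    by apply: Ck_sub Cw; exact: subIsetl.
  + move=> [t' e'] [[_ be] Ue] /= [t'0 /andP[e'0 e'd]].
    rewrite gE//=; last by rewrite t'0 e'0 Wd// sqdel.
    by rewrite muc_sqr.
- move=> lam /andP[l0 ld] mu.
  have Dl : 0 <= lam < del1 by rewrite (ltW l0).
  have Dl' := lt_del _ Dl.
  have l0' : 0 < lam < del by rewrite l0; case/andP: Dl'.
  have mud : `|mu| < del := muc_del _ Dl.
  have fr := bb_frequency bb l0' mud.
  have [qW _] := bb_X_qD bb.
  have [sW W2] := qD_rnorm (qW mu lam mud Dl').
  have Tpos : 0 < T lam mu.
    have [om_neq0 _] := omP lam mu Dl' mud.
    by rewrite divr_gt0 ?mulr_gt0 ?pi_gt0// normr_gt0; apply/eqP.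
  split.
  + exact: (bb_stable bb l0' mud).
  + exact: fr.
  (* A periodic solution has |X| T = 2 pi l, and |X| T < 2 pi leaves l = 0. *)
  + move=> XN0; case: fr => // -[[_ _ _] sX [l Xl]]; exfalso; apply: XN0.
    apply: (so3_rnorm0 sX).
    have TX : rnorm (T lam mu *: X lam mu) = 2 * pi * l%:~R.
      by rewrite rnormZ gtr0_norm// Xl -/(T lam mu); field; rewrite lt0r_neq0.
    have pi0 := pi_gt0 R.
    have pi2 : 0 < 2 * pi :> R by rewrite mulr_gt0.
    have l_ge0 : 0 <= l.
      by rewrite -(ler0z R) -(pmulr_rge0 _ pi2) -TX rnorm_ge0.
    have l_lt1 : l < 1.
      by rewrite -(ltrz1 R) -(ltr_pM2l pi2) mulr1 -TX.
    have l0E : l = 0 by apply/eqP; rewrite eq_le l_ge0 -ltzD1 add0r l_lt1.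
    rewrite Xl l0E.
    by rewrite mulr0 mul0r mul0r.
  + have [We trB frB] := phiP _ (ball_d _ (sqrt_lam _ Dl)).
    have [_ BA] := BE _ _ We.
    have sl : 0 <= Num.sqrt lam < Num.sqrt del.
      by rewrite sqrtr_ge0 ltr_sqrt//; case/andP: Dl'.
    move: trB frB; rewrite BA// sqr_sqrtr ?(ltW l0)// -/(muc lam) -/mu.
    rewrite (bb_X bb Dl' mud) => trB frB.
    have := expmx_frob_orthogonal sX0 sW W2 trB frB.
    rewrite dotv_axialZl => /eqP.
    by rewrite mulf_eq0 (negbTE (lt0r_neq0 Tpos)) => /eqP.
Unshelve. all: by end_near. Qed.
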